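(* Let $T>0$, $r\in[1,\infty)$, $\alpha>0$ and $p,q\in(0,\infty]$ with $\frac1\alpha<r\le p$. There exists a constant $c=c(\alpha,r,p,q)$ such that for every continuous $\chi:\Delta_T\to[0,\infty)$ that is subadditive, i.e. $\chi(s,t)\le\chi(s,u)+\chi(u,t)$ for all $0\le s\le u\le t\le T$, one has $$\|V^r\chi\|_{B^\alpha_{p,q}}\le c\,\|\chi\|_{B^\alpha_{p,q}} .$$
   Context: $\Delta_T=\{(s,t)\in[0,T]^2:s\le t\}$. For (measurable) $\chi:\Delta_T\to[0,\infty]$, $$\Omega^\chi_p(t)=\sup_{0<h\le t}\Big(\int_0^{T-h}\chi(s,s+h)^p\,ds\Big)^{1/p},\qquad\|\chi\|_{B^\alpha_{p,q}}=\Big(\int_0^T\Big(\frac{\Omega^\chi_p(t)}{t^\alpha}\Big)^q\frac{dt}t\Big)^{1/q},$$ with the usual modifications if $p=\infty$ or $q=\infty$. $V^r\chi$ is the two-parameter function $(s,t)\mapsto V^r\chi_{[s,t]}=\sup_\pi\big(\sum_{i=1}^{N-1}\chi(\pi_i,\pi_{i+1})^r\big)^{1/r}$, the supremum being over all finite increasing sequences $\pi=\{\pi_1<\dots<\pi_N\}\subset[s,t]$. The inequality is understood in $[0,\infty]$. *)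

(* Defs.v *)
From HB Require Import structures.
From mathcomp Require Import all_boot all_order all_algebra.
From mathcomp Require Import all_classical all_reals all_analysis.
Import Order.TTheory GRing.Theory Num.Theory.
Import numFieldNormedType.Exports.

Set Implicit Arguments.
Unset Strict Implicit.
Unset Printing Implicit Defensive.

Local Open Scope classical_set_scope.
Local Open Scope ring_scope.

(* Two-parameter functions are total functions on R * R; the definitions below
   only use their values on Delta T. *)
Definition Delta (R : realType) (T : R) : set (R * R) :=
  [set st | 0 <= st.1 /\ st.1 <= st.2 /\ st.2 <= T].

Definition subadditive_on (R : realType) (T : R) (chi : R * R -> R) : Prop :=
  forall s u t : R, 0 <= s -> s <= u -> u <= t -> t <= T ->
    chi (s, t) <= chi (s, u) + chi (u, t).

Definition partition_sum (R : realType) (r : R) (chi : R * R -> \bar R)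
    (pi : seq R) : \bar R :=
  ((\sum_(i < (size pi).-1) chi (nth 0%R pi i, nth 0%R pi i.+1) `^ r) `^ r^-1)%E.

(* The sequences pi need not contain the end points s and t. *)
Definition rvariation (R : realType) (r : R) (chi : R * R -> \bar R)
    (st : R * R) : \bar R :=
  ereal_sup [set partition_sum r chi pi | pi in
    [set pi : seq R | sorted <%R pi /\
                      forall x, x \in pi -> st.1 <= x /\ x <= st.2]].

(* The L^p norm on [0, T - h] of s |-> chi (s, s + h), for p in ]0, +oo]: the
   function is extended by 0 outside of [0, T - h], and Lnorm is an essential
   supremum for p = +oo. *)
Definition increment_norm (R : realType) (T : R) (p : \bar R)
    (chi : R * R -> \bar R) (h : R) : \bar R :=
  Lnorm (@lebesgue_measure R) p ((fun s => chi (s, s + h)) \_ `[0, T - h]).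

Definition Omega (R : realType) (T : R) (p : \bar R)
    (chi : R * R -> \bar R) (t : R) : \bar R :=
  ereal_sup [set increment_norm T p chi h | h in `]0, t]].

(* For q = +oo the essential supremum is taken for Lebesgue measure, which has
   the same null sets on ]0, T] as dt / t. The value at q = -oo is junk. *)
Definition besov (R : realType) (T alpha : R) (p q : \bar R)
    (chi : R * R -> \bar R) : \bar R :=
  match q with
  | q'%:E => ((\int[@lebesgue_measure R]_(t in `]0%R, T])
                 ((Omega T p chi t * ((t `^ alpha)^-1)%:E) `^ q' * (t^-1)%:E))
              `^ q'^-1)%E
  | +oo%E => Lnorm (@lebesgue_measure R) +oo%E
               ((fun t => Omega T p chi t * ((t `^ alpha)^-1)%:E)%E \_ `]0, T])
  | -oo%E => 0%E
  end.

(* Main.v *)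
Require Import Defs.
From HB Require Import structures.
From mathcomp Require Import all_boot all_order all_algebra.
From mathcomp Require Import all_classical all_reals all_analysis.
From mathcomp Require Import measurable_realfun ess_sup_inf ring lra zify.
Import Order.TTheory GRing.Theory Num.Theory.
Import numFieldNormedType.Exports.

(** Fix an interval [s, s + h] and cut it into 2 ^ j intervals of equal length,
    for every level j. Subadditivity writes any interval [x, y] with dyadic end
    points as a chain that uses at most two dyadic intervals of each level, all
    contained in [x, y] (dyadic_chaining). The sum of chi ^ r over the level-j
    intervals contained in [x, y] is superadditive in (x, y). Weighted by
    a geometric sequence, these sums form a control that dominates
    chi (x, y) ^ r, so summing over a partition costs nothing, and
    continuity passes from dyadic to arbitrary partitions. Hence, if the sum of
    chi ^ r over level j is at most (B * rho ^ (2 j)) ^ r for all j >= 1, then the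
    r-variation over [s, s + h] is at most a constant times B (rvariation_le).

    Next take the L^p norm in s. As r <= p, sums of r-th powers are bounded by
    sums of p-th powers, and by translation invariance each of the 2 ^ j
    increments of step h / 2 ^ j contributes at most Omega (h / 2 ^ j). This gives
    Omega_rvariation_le: with tau = rho ^ 3 * 2 ^ (- 1 / r), if the modulus of chi
    satisfies Omega (t / 2 ^ j) <= tau ^ j * G for all j >= 1, then the modulus of
    the r-variation at t is at most a constant times G.

    The hypothesis 1 / alpha < r says that 2 ^ (- alpha) < 2 ^ (- 1 / r), so rho < 1
    can be chosen with 2 ^ (- alpha) < tau. What remains concerns two
    nondecreasing functions only and is a discrete Hardy inequality. Cut ]0, T]
    into the blocks ]T / 2 ^ (k + 1), T / 2 ^ k]. On a block t ^ alpha is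
    constant up to a factor, and the Besov norm becomes a weighted l^q norm of the
    sequence Omega (T / 2 ^ k). The previous bound is a convolution of that sequence
    with a geometric one, of ratio (2 ^ (- alpha) / tau) ^ q < 1
    (besov_integral_le). For q = oo the essential supremum of
    Omega t / t ^ alpha bounds Omega s / s ^ alpha at every s <= T / 2 up to
    a factor (besov_sup_le). None of the constants involves T. *)

Local Open Scope classical_set_scope.
Local Open Scope ring_scope.

(** * Powers and geometric series *)

Lemma powRK {R : realType} (r x : R) : 0 < r -> 0 <= x -> (x `^ r) `^ r^-1 = x.
Proof. by move=> r0 x0; rewrite -powRrM mulfV ?gt_eqF// powRr1. Qed.

Lemma powRVK {R : realType} (r x : R) : 0 < r -> 0 <= x -> (x `^ r^-1) `^ r = x.
Proof. by move=> r0 x0; rewrite -powRrM mulVf ?gt_eqF// powRr1. Qed.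

Lemma ler_powRl {R : realType} (r x y : R) : 0 < r -> 0 <= x -> x <= y ->
  x `^ r <= y `^ r.
Proof.
move=> r0 x0 xy; apply: ge0_ler_powR; rewrite ?nnegrE ?(ltW r0)//.
exact: le_trans xy.
Qed.

Lemma powR_expr {R : realType} (x a : R) n : 0 <= x -> (x ^+ n) `^ a = (x `^ a) ^+ n.
Proof. by move=> x0; rewrite -powR_mulrn// powRAC powR_mulrn// powR_ge0. Qed.

Lemma expr3M {R : realType} (x y : R) m :
  (x ^+ 3 * y) ^+ m = x ^+ m * x ^+ m.*2 * y ^+ m.
Proof.
by rewrite exprMn -exprM -exprD; congr (_ ^+ _ * _); rewrite -addnn mulSn mul2n addnn.
Qed.

Lemma le_poweR {R : realType} (a : R) (x y : \bar R) : 0 <= a ->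
  (0 <= x)%E -> (x <= y)%E -> (x `^ a <= y `^ a)%E.
Proof.
move=> a0 x0 xy; apply: gt0_ler_poweR => //; rewrite in_itv/= leey andbT//.
exact: le_trans xy.
Qed.

Lemma poweRVK {R : realType} (a : R) (x : \bar R) : 0 < a -> (0 <= x)%E ->
  ((x `^ a^-1) `^ a = x)%E.
Proof. by move=> a0 x0; rewrite -poweRrM mulVf ?gt_eqF// poweRe1. Qed.

Lemma poweRK {R : realType} (a : R) (x : \bar R) : 0 < a -> (0 <= x)%E ->
  ((x `^ a) `^ a^-1 = x)%E.
Proof. by move=> a0 x0; rewrite -poweRrM mulfV ?gt_eqF// poweRe1. Qed.

(** With l chosen so that l ^ p is the mean of the x i ^ p, this compares power
    means up to the factor 2; it follows by summing the pointwise bound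
    x ^ r <= l ^ (r - p) * x ^ p + l ^ r, whose two terms cover x > l and x <= l. *)
Lemma power_mean_le {R : realType} (r p l : R) (N : nat) (x : nat -> R) :
  0 < r -> r <= p -> 0 <= l -> (forall i, (i < N)%N -> 0 <= x i) ->
  \sum_(i < N) x i `^ p <= N%:R * l `^ p ->
  \sum_(i < N) x i `^ r <= 2 * N%:R * l `^ r.
Proof.
move=> r0 rp; have p0 : 0 < p by exact: lt_le_trans rp.
rewrite le_eqVlt => /predU1P[<-|l0] x0 xp.
  rewrite powR0 ?gt_eqF// mulr0 in xp.
  rewrite big1 ?mulr_ge0 ?powR_ge0// => i _.
  have : x i `^ p <= 0.
    apply: le_trans xp; rewrite (bigD1 i)//= lerDl sumr_ge0// => k _.
    exact: powR_ge0.
  by rewrite le_eqVlt ltNge powR_ge0 orbF => /eqP/powR_eq0_eq0->; rewrite powR0// gt_eqF.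
have pt (y : R) : 0 <= y -> y `^ r <= l `^ (r - p) * y `^ p + l `^ r.
  move=> y0; have [yl|ly] := leP y l.
    by rewrite ler_wpDl ?mulr_ge0 ?powR_ge0// ler_powRl.
  have y0' : 0 < y by exact: lt_trans ly.
  have yrE : y `^ r = y `^ (r - p) * y `^ p.
    by rewrite -powRD ?subrK// gt_eqF ?implybT.
  rewrite ler_wpDr ?powR_ge0// yrE ler_wpM2r ?powR_ge0//.
  rewrite -[r - p]opprB !powRN lef_pV2 ?posrE ?powR_gt0//.
  by apply: ge0_ler_powR; rewrite ?nnegrE ?subr_ge0// ltW.
rewrite (@le_trans _ _ (\sum_(i < N) (l `^ (r - p) * x i `^ p + l `^ r)))//.
  by apply: ler_sum => i _; apply/pt/x0.
have xp' : l `^ (r - p) * \sum_(i < N) x i `^ p <= N%:R * l `^ r.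
  rewrite (le_trans (ler_wpM2l (powR_ge0 _ _) xp))//.
  by rewrite mulrCA -powRD ?subrK// gt_eqF ?implybT.
by rewrite big_split/= sumr_const card_ord -mulr_sumr -mulr_natl; lra.
Qed.

Lemma sum_expr_le {R : realType} (rho : R) n : 0 < rho -> rho < 1 ->
  \sum_(j < n) rho ^+ j <= (1 - rho)^-1.
Proof.
move=> rho0 rho1; have d0 : 0 < 1 - rho by rewrite subr_gt0.
rewrite -[leRHS]mul1r ler_pdivlMr// mulrC -opprB mulNr -subrX1 opprB.
by rewrite gerBl exprn_ge0// ltW.
Qed.

Lemma cvg_div_exp2 {R : realType} (x : R) : (fun n => x / 2 ^+ n) @ \oo --> (0 : R).
Proof.
have := @cvg_geometric R x 2^-1; rewrite ger0_norm ?invr_ge0// invf_lt1// ltr1n => /(_ isT).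
by apply: cvg_trans; apply: near_eq_cvg; apply: nearW => n /=; rewrite exprVn.
Qed.

Lemma nneseries_le_bound {R : realType} (u : nat -> \bar R) (M : \bar R) :
  (forall n, 0 <= u n)%E -> (forall n, \sum_(0 <= i < n) u i <= M)%E ->
  (\sum_(i <oo) u i <= M)%E.
Proof.
by move=> u0 uM; apply: lime_le; [apply: is_cvg_nneseries => *; exact: u0|exact: nearW].
Qed.

Lemma nneseries_geometric_le {R : realType} (rho a : R) : 0 < rho -> rho < 1 -> 0 <= a ->
  (\sum_(i <oo) (a * rho ^+ i)%:E <= (a / (1 - rho))%:E)%E.
Proof.
move=> rho0 rho1 a0; apply: nneseries_le_bound => n.
  by rewrite lee_fin mulr_ge0// exprn_ge0// ltW.
by rewrite sumEFin lee_fin -mulr_sumr ler_wpM2l// big_mkord sum_expr_le.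
Qed.

Lemma sume_const {R : realType} (x : \bar R) n : (0 <= x)%E ->
  (\sum_(i < n) x = n%:R%:E * x)%E.
Proof.
move=> x0; elim: n => [|n IHn]; first by rewrite big_ord0 mul0e.
by rewrite big_ord_recr/= IHn -[n.+1%:R]natr1 EFinD ge0_muleDl ?mul1e// lee_fin.
Qed.

Lemma nneseries_shift_le {R : realType} (f : nat -> \bar R) n : (forall k, 0 <= f k)%E ->
  (\sum_(k <oo) f (k + n)%N <= \sum_(k <oo) f k)%E.
Proof.
move=> f0; rewrite nneseries_addn// [leRHS](nneseries_split 0 n)// add0n leeDr//.
by apply: sume_ge0.
Qed.

Lemma nneseries_geometricM_le {R : realType} (rho : R) (B : \bar R) :
  0 < rho -> rho < 1 -> (0 <= B)%E ->
  (\sum_(i <oo) (rho ^+ i.+1)%:E * B <= ((1 - rho)^-1)%:E * B)%E.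
Proof.
move=> rho0 rho1; have d0 : 0 < 1 - rho by rewrite subr_gt0.
case: B => [b|_|//]; last by rewrite gt0_muley ?leey// lte_fin invr_gt0.
rewrite lee_fin => b0; rewrite -EFinM mulrC.
apply: le_trans (nneseries_geometric_le rho b rho0 rho1 b0).
apply: lee_nneseries => [i _ _|i _].
  by rewrite -EFinM lee_fin mulr_ge0// exprn_ge0// ltW.
rewrite -EFinM lee_fin mulrC ler_wpM2l// exprS ler_piMl ?exprn_ge0// ltW//.
Qed.

(** * Translations and monotonicity for the Lebesgue integral *)

Definition translation {R : realType} (c : R) : measurableTypeR R -> measurableTypeR R :=
  fun x => x + c.

Lemma measurable_translation {R : realType} (c : R) : measurable_fun setT (translation c).
Proof.
apply: continuous_measurable_fun => x.
by apply: (@cvgD _ R^o); [exact: cvg_id|exact: cvg_cst].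
Qed.

HB.instance Definition _ {R : realType} (c : R) :=
  isMeasurableFun.Build _ _ _ _ (translation c) (measurable_translation c).

Lemma lebesgue_measure_translation {R : realType} (c : R) (A : set R) : measurable A ->
  pushforward (@lebesgue_measure R) (translation c) A = lebesgue_measure A.
Proof.
move=> mA; apply/esym/lebesgue_measure_unique => //= _ [[a b]] _ <-.
rewrite /pushforward (_ : _ @^-1` _ = `]a - c, b - c]%classic); last first.
  by apply/seteqP; split=> x/=; rewrite /translation !in_itv/= ltrBlDr lerBrDr.
rewrite !lebesgue_measure_itv/= !lte_fin ltrD2r; case: ifP => // _.
by rewrite -!EFinB opprB addrA subrK.
Qed.

Lemma ge0_integral_translation {R : realType} (c : R) (f : R -> \bar R) :
  measurable_fun [set: R] f -> (forall x, 0 <= f x)%E ->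
  (\int[@lebesgue_measure R]_x f (translation c x) = \int[@lebesgue_measure R]_x f x)%E.
Proof.
move=> mf f0.
have -> : (\int[@lebesgue_measure R]_x f (translation c x) =
    \int[pushforward (@lebesgue_measure R) (translation c)]_x f x)%E.
  rewrite (ge0_integral_pushforward (measurable_translation c)) ?preimage_setT//.
by apply: eq_measure_integral => A mA _; exact: lebesgue_measure_translation.
Qed.

Lemma ae_translation {R : realType} (c : R) (P : set R) :
  {ae @lebesgue_measure R, forall x, P x} ->
  {ae @lebesgue_measure R, forall x, P (translation c x)}.
Proof.
move=> [A [mA A0 PA]]; exists (translation c @^-1` A); split.
- by rewrite -[_ @^-1` _]setTI; exact: measurable_translation.
- by rewrite -[RHS]A0 -[RHS](lebesgue_measure_translation c).
- by move=> x /= Px; apply: PA.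
Qed.

(** The r-variation is a supremum over uncountably many partitions. It is only
    ever bounded from above, so its integral is estimated without knowing that it
    is measurable. *)
Lemma ge0_le_integralT {d} {X : measurableType d} {R : realType}
    (mu : {measure set X -> \bar R}) (f g : X -> \bar R) :
  (forall x, 0 <= f x)%E -> (forall x, f x <= g x)%E ->
  (\int[mu]_x f x <= \int[mu]_x g x)%E.
Proof.
move=> f0 fg; have g0 x : (0 <= g x)%E by exact: le_trans (fg x).
rewrite !ge0_integralTE//; apply: ereal_sup_le; apply: image_subset => h hf x.
exact: le_trans (fg x).
Qed.

Lemma lebesgue_measure_setT_gt0 {R : realType} : (0 < @lebesgue_measure R [set: R])%E.
Proof. by rewrite -set_itvNyy lebesgue_measure_itv/= ltry. Qed.

Lemma nondecreasing_emeasurable {R : realType} (D : set R) (A : R -> \bar R) :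
  measurable D -> (forall s t, s <= t -> (A s <= A t)%E) -> measurable_fun D A.
Proof.
move=> mD Ale _; suff : measurable_fun setT A by move/measurable_funS; exact.
move=> {mD} _; apply: (measurability _ (ErealGenCInfty.measurableE R)) => // _ [_ [y ->] <-].
rewrite setTI; apply: is_interval_measurable => s t /=.
rewrite !in_itv/= !andbT => ys _ z /andP[sz _].
by rewrite in_itv/= andbT (le_trans ys)// Ale.
Qed.

(** * Dyadic chaining *)

Definition dyadic {R : realType} (s h : R) (n a : nat) : R := s + h * a%:R / 2 ^+ n.

(** The part of the level-j sum that lives on the dyadic intervals contained in
    [x, y]. Restricting to contained intervals is what makes it superadditive
    in (x, y). *)
Definition dyadic_sum {R : realType} (r : R) (f : R -> R -> R) (s h : R) (j : nat)
    (x y : R) : R :=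
  \sum_(i < 2 ^ j | (x <= dyadic s h j i) && (dyadic s h j i.+1 <= y))
     f (dyadic s h j i) (dyadic s h j i.+1) `^ r.

Lemma dyadicS {R : realType} (s h : R) n a : dyadic s h n.+1 a.*2 = dyadic s h n a.
Proof.
rewrite /dyadic -muln2 natrM exprS invfM !mulrA; congr (_ + _ * _).
by rewrite -!mulrA divff ?mulr1// pnatr_eq0.
Qed.

Lemma dyadic_le {R : realType} (s h : R) n a b : 0 <= h -> (a <= b)%N ->
  dyadic s h n a <= dyadic s h n b.
Proof.
by move=> h0 ab; rewrite lerD2l ler_pM2r ?invr_gt0 ?exprn_gt0// ler_wpM2l ?ler_nat.
Qed.

Lemma dyadic_lt {R : realType} (s h : R) n a b : 0 < h -> (a < b)%N ->
  dyadic s h n a < dyadic s h n b.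
Proof.
by move=> h0 ab; rewrite ltrD2l ltr_pM2r ?invr_gt0 ?exprn_gt0// ltr_pM2l ?ltr_nat.
Qed.

Lemma dyadic0 {R : realType} (s h : R) n : dyadic s h n 0 = s.
Proof. by rewrite /dyadic mulr0 mul0r addr0. Qed.

Lemma dyadic_max {R : realType} (s h : R) n : dyadic s h n (2 ^ n) = s + h.
Proof. by rewrite /dyadic natrX mulfK ?expf_neq0. Qed.

Lemma dyadic_sum_ge0 {R : realType} (r : R) f s h j x y :
  0 <= dyadic_sum r f s h j x y.
Proof. by apply: sumr_ge0 => i _; exact: powR_ge0. Qed.

Lemma dyadic_sum_le {R : realType} (r : R) f s h j x y x' y' :
  x' <= x -> y <= y' -> dyadic_sum r f s h j x y <= dyadic_sum r f s h j x' y'.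
Proof.
move=> xx yy; rewrite /dyadic_sum [leLHS]big_mkcond [leRHS]big_mkcond.
apply: ler_sum => i _.
case: ifPn => [/andP[xi iy]|_]; first by rewrite (le_trans xx)// (le_trans iy).
by case: ifP => // _; exact: powR_ge0.
Qed.

Lemma dyadic_sum_superadditive {R : realType} (r : R) f s h j x y z : 0 < h ->
  x <= y -> y <= z ->
  dyadic_sum r f s h j x y + dyadic_sum r f s h j y z <= dyadic_sum r f s h j x z.
Proof.
move=> h0 xy yz; rewrite /dyadic_sum [X in X + _]big_mkcond [X in _ + X]big_mkcond.
rewrite [leRHS]big_mkcond -big_split/=; apply: ler_sum => i _.
have lt_i := dyadic_lt s h j i i.+1 h0 (ltnSn i).
case: ifPn => [/andP[xi iy]|_]; case: ifPn => [/andP[yi iz]|_].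
- by move: (lt_le_trans lt_i iy); rewrite ltNge yi.
- by rewrite addr0 xi (le_trans iy).
- by rewrite add0r (le_trans xy yi) iz.
- by rewrite addr0; case: ifP; rewrite ?powR_ge0.
Qed.

Lemma dyadic_term_le {R : realType} (r : R) f s h j a b c : 1 <= r ->
  (0 <= f (dyadic s h j c) (dyadic s h j c.+1)) -> 0 <= h ->
  (a <= c)%N -> (c < b)%N -> (b <= 2 ^ j)%N ->
  f (dyadic s h j c) (dyadic s h j c.+1) <=
   dyadic_sum r f s h j (dyadic s h j a) (dyadic s h j b) `^ r^-1.
Proof.
move=> r1 f0 h0 ac cb bj; have r0 : 0 < r by rewrite (lt_le_trans _ r1).
have cj : (c < 2 ^ j)%N by rewrite (leq_trans cb).
rewrite -[leLHS](powRK r)//.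
apply: ge0_ler_powR; rewrite ?invr_ge0 ?nnegrE ?powR_ge0 ?dyadic_sum_ge0 ?(ltW r0)//.
have c_in : (dyadic s h j a <= dyadic s h j (Ordinal cj)) &&
    (dyadic s h j (Ordinal cj).+1 <= dyadic s h j b) by rewrite /= !dyadic_le.
rewrite /dyadic_sum (bigD1 (Ordinal cj) c_in)/=.
by rewrite lerDl sumr_ge0// => i _; rewrite powR_ge0.
Qed.

(** Rounding a up and b down to the next coarser level costs at most one
    interval of level n at each end, whence the factor 2; the middle part has
    coarser end points, and the induction on n takes over. *)
Lemma dyadic_chaining {R : realType} (r : R) (f : R -> R -> R) (s h : R) :
  1 <= r -> 0 < h ->
  (forall x y, s <= x -> x <= y -> y <= s + h -> 0 <= f x y) ->
  (forall x, f x x = 0) ->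
  (forall x y z, s <= x -> x <= y -> y <= z -> z <= s + h -> f x z <= f x y + f y z) ->
  forall n a b, (a <= b)%N -> (b <= 2 ^ n)%N ->
  f (dyadic s h n a) (dyadic s h n b) <=
  \sum_(j < n.+1) 2 * dyadic_sum r f s h j (dyadic s h n a) (dyadic s h n b) `^ r^-1.
Proof.
move=> r1 h0 fge0 f_diag fsub.
have sD n a : s <= dyadic s h n a by have := dyadic_le s h n 0 a (ltW h0) (leq0n a); rewrite dyadic0.
have Dsh n a : (a <= 2 ^ n)%N -> dyadic s h n a <= s + h.
  by move=> an; rewrite -(dyadic_max s h n) dyadic_le// ltW.
have term_ge0 n a : (a < 2 ^ n)%N -> 0 <= f (dyadic s h n a) (dyadic s h n a.+1).
  by move=> an; apply: fge0; rewrite ?sD ?Dsh ?dyadic_le// ltW.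
elim=> [|n IHn] a b ab bn.
  rewrite big_ord1; move: ab; rewrite leq_eqVlt => /predU1P[->|ab].
    by rewrite f_diag mulr_ge0// powR_ge0.
  have -> : b = a.+1 by move: ab bn; case: a b => [|a] [|[|b]].
  rewrite (@le_trans _ _ (dyadic_sum r f s h 0 (dyadic s h 0 a) (dyadic s h 0 a.+1) `^ r^-1))//.
    by apply: dyadic_term_le; rewrite ?(ltW h0) ?term_ge0// (leq_trans ab).
  by rewrite ler_peMl ?powR_ge0// ler1n.
move: ab; rewrite leq_eqVlt => /predU1P[->|ab].
  by rewrite f_diag sumr_ge0// => j _; rewrite mulr_ge0// powR_ge0.
(* a'.*2 is a rounded up and b'.*2 is b rounded down to an even number. *)
have [a' [a'E aa']] : exists a', (a <= a'.*2)%N /\ (a'.*2 <= a.+1)%N.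
  by exists (uphalf a); lia.
have [b' [b'E bb']] : exists b', (b'.*2 <= b)%N /\ (b <= b'.*2.+1)%N.
  by exists (half b); lia.
have ab' : (a' <= b')%N. by lia.
have b'n : (b' <= 2 ^ n)%N by rewrite -leq_double -[leqRHS]mul2n -expnS (leq_trans b'E).
set x := dyadic s h n.+1 a; set y := dyadic s h n.+1 b.
have xa' : x <= dyadic s h n a' by rewrite -dyadicS dyadic_le// ltW.
have b'y : dyadic s h n b' <= y by rewrite -dyadicS dyadic_le// ltW.
have la : f x (dyadic s h n a') <= dyadic_sum r f s h n.+1 x y `^ r^-1.
  move: a'E; rewrite leq_eqVlt => /predU1P[aE|aE].
    by rewrite /x aE dyadicS f_diag powR_ge0.
  have a'eq : a'.*2 = a.+1 by apply/eqP; rewrite eqn_leq aa'.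
  rewrite -dyadicS a'eq; apply: dyadic_term_le; rewrite ?(ltW h0)//.
  by apply: term_ge0; rewrite (leq_trans ab).
have lb : f (dyadic s h n b') y <= dyadic_sum r f s h n.+1 x y `^ r^-1.
  move: bb'; rewrite leq_eqVlt => /predU1P[bE|]; last first.
    by rewrite ltnS => bE; rewrite /y (_ : b = b'.*2) ?dyadicS ?f_diag ?powR_ge0//;
       apply/eqP; rewrite eqn_leq bE.
  rewrite -dyadicS /y bE; apply: dyadic_term_le; rewrite ?(ltW h0) -?bE//.
    by rewrite bE; apply: term_ge0; rewrite -bE.
  by rewrite -ltnS -bE.
have lm : f (dyadic s h n a') (dyadic s h n b') <=
    \sum_(j < n.+1) 2 * dyadic_sum r f s h j x y `^ r^-1.
  apply: (le_trans (IHn _ _ ab' b'n)); apply: ler_sum => j _.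
  rewrite ler_pM2l//; apply: ge0_ler_powR;
    by rewrite ?invr_ge0 ?nnegrE ?(le_trans _ r1) ?dyadic_sum_ge0 ?dyadic_sum_le.
have a'b' : dyadic s h n a' <= dyadic s h n b' by rewrite dyadic_le// ltW.
have ysh : y <= s + h by apply: Dsh.
have := fsub x (dyadic s h n a') y (sD _ _) xa' (le_trans a'b' b'y) ysh.
have := fsub (dyadic s h n a') (dyadic s h n b') y (sD _ _) a'b' b'y ysh.
by rewrite big_ord_recr/=; lra.
Qed.

Lemma superadditive_sum_le {R : realType} (F : R -> R -> R) (x : nat -> R) N :
  (forall a b c, a <= b -> b <= c -> F a b + F b c <= F a c) ->
  (forall a, 0 <= F a a) -> (forall i, (i < N)%N -> x i <= x i.+1) ->
  \sum_(i < N) F (x i) (x i.+1) <= F (x 0) (x N).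
Proof.
move=> Fsup F0; elim: N => [|N IHN] xle; first by rewrite big_ord0.
have IH : \sum_(i < N) F (x i) (x i.+1) <= F (x 0) (x N).
  by apply: IHN => i iN; apply: xle; rewrite ltnW.
have x0N : x 0 <= x N.
  elim: (N) xle {IH IHN} => // m IHm xle.
  by rewrite (le_trans (IHm _) (xle m _))// => i im; rewrite xle// ltnW.
rewrite big_ord_recr/= (le_trans _ (Fsup _ _ _ x0N (xle N (ltnSn N))))//.
by rewrite lerD2r.
Qed.

(** Vanishing on the diagonal lets degenerate intervals occur freely in the
    chaining and in rounded partitions. *)
Definition interval_subadditive {R : realType} (f : R -> R -> R) (a b : R) : Prop :=
  [/\ forall x y, a <= x -> x <= y -> y <= b -> 0 <= f x y,
      forall x, f x x = 0 &
      forall x y z, a <= x -> x <= y -> y <= z -> z <= b -> f x z <= f x y + f y z].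

(** A control function in the sense of rough path theory. The weights pay for
    exchanging the power r with the sum over the levels. *)
Definition dyadic_control {R : realType} (r rho : R) f (s h : R) (n : nat) (x y : R) : R :=
  \sum_(j < n.+1) (rho ^+ j) `^ (- r) * dyadic_sum r f s h j x y.

Lemma dyadic_control_ge0 {R : realType} (r rho : R) f s h n x y :
  0 <= dyadic_control r rho f s h n x y.
Proof. by apply: sumr_ge0 => j _; rewrite mulr_ge0 ?powR_ge0 ?dyadic_sum_ge0. Qed.

Lemma dyadic_control_superadditive {R : realType} (r rho : R) f s h n x y z : 0 < h ->
  x <= y -> y <= z ->
  dyadic_control r rho f s h n x y + dyadic_control r rho f s h n y z <=
  dyadic_control r rho f s h n x z.
Proof.
move=> h0 xy yz; rewrite /dyadic_control -big_split/=; apply: ler_sum => j _.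
by rewrite -mulrDr ler_wpM2l ?powR_ge0 ?dyadic_sum_superadditive.
Qed.

(** Each level satisfies dyadic_sum ^ (1 / r) <= rho ^ j * Z ^ (1 / r), where Z
    is the control, so that the chaining bound becomes a geometric series. *)
Lemma powR_le_dyadic_control {R : realType} (r rho : R) (f : R -> R -> R) (s h : R) :
  1 <= r -> 0 < rho -> rho < 1 -> 0 < h -> interval_subadditive f s (s + h) ->
  forall n a b, (a <= b)%N -> (b <= 2 ^ n)%N ->
  f (dyadic s h n a) (dyadic s h n b) `^ r <=
  (2 / (1 - rho)) `^ r * dyadic_control r rho f s h n (dyadic s h n a) (dyadic s h n b).
Proof.
move=> r1 rho0 rho1 h0 [fge0 f_diag fsub] n a b ab bn.
have r0 : 0 < r by rewrite (lt_le_trans _ r1).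
have ch := dyadic_chaining _ _ _ _ r1 h0 fge0 f_diag fsub n a b ab bn.
set x := dyadic s h n a in ch *; set y := dyadic s h n b in ch *.
set Z := dyadic_control _ _ _ _ _ _ _ _.
have Z0 : 0 <= Z by exact: dyadic_control_ge0.
have c0 : 0 <= 2 / (1 - rho) by rewrite divr_ge0// subr_ge0 ltW.
have zj (j : 'I_n.+1) : dyadic_sum r f s h j x y `^ r^-1 <= rho ^+ j * Z `^ r^-1.
  have rj0 : 0 < rho ^+ j by rewrite exprn_gt0.
  have -> : rho ^+ j = ((rho ^+ j) `^ r) `^ r^-1.
    by rewrite powRK// ltW.
  rewrite -powRM ?powR_ge0//; apply: ge0_ler_powR;
    rewrite ?nnegrE ?mulr_ge0 ?powR_ge0 ?invr_ge0 ?(ltW r0) ?dyadic_sum_ge0//.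
  rewrite mulrC -ler_pdivrMr ?powR_gt0// mulrC -powRN.
  rewrite /Z /dyadic_control (bigD1 j)//= lerDl sumr_ge0// => i _.
  by rewrite mulr_ge0 ?powR_ge0 ?dyadic_sum_ge0.
have fle : f x y <= 2 / (1 - rho) * Z `^ r^-1.
  apply: (le_trans ch); rewrite -mulr_sumr -mulrA ler_pM2l//.
  apply: (le_trans (ler_sum _ (fun j _ => zj j))).
  by rewrite -mulr_suml ler_wpM2r ?powR_ge0// sum_expr_le.
have ZE : (Z `^ r^-1) `^ r = Z by rewrite powRVK.
rewrite -[X in _ <= _ * X]ZE -powRM ?powR_ge0//.
apply: ge0_ler_powR; rewrite ?nnegrE ?(ltW r0) ?(mulr_ge0 c0) ?powR_ge0//.
apply: fge0.
- by have := dyadic_le s h n 0 a (ltW h0) (leq0n a); rewrite dyadic0.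
- by rewrite dyadic_le// ltW.
- by rewrite -(dyadic_max s h n) dyadic_le// ltW.
Qed.

(** Superadditivity of the control sums up the bound over all intervals of the
    partition without any loss in their number. *)
Lemma dyadic_partition_le {R : realType} (r rho B : R) (f : R -> R -> R) (s h : R)
    (n N : nat) (a : nat -> nat) :
  1 <= r -> 0 < rho -> rho < 1 -> 0 < h -> 0 <= B ->
  interval_subadditive f s (s + h) ->
  (forall j, dyadic_sum r f s h j s (s + h) <= (B * rho ^+ j.*2) `^ r) ->
  (forall i, (i < N)%N -> (a i <= a i.+1)%N) ->
  (forall i, (i <= N)%N -> (a i <= 2 ^ n)%N) ->
  \sum_(i < N) f (dyadic s h n (a i)) (dyadic s h n (a i.+1)) `^ r <=
  (2 * B / (1 - rho) ^+ 2) `^ r.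
Proof.
move=> r1 rho0 rho1 h0 B0 fS HM ale an.
have r0 : 0 < r by rewrite (lt_le_trans _ r1).
have d0 : 0 < 1 - rho by rewrite subr_gt0.
have c0 : 0 <= 2 / (1 - rho) by rewrite divr_ge0// ltW.
set F := dyadic_control r rho f s h n.
apply: (@le_trans _ _ ((2 / (1 - rho)) `^ r * F s (s + h))).
  rewrite (@le_trans _ _ (\sum_(i < N) (2 / (1 - rho)) `^ r *
      F (dyadic s h n (a i)) (dyadic s h n (a i.+1))))//.
    by apply: ler_sum => i _; apply: powR_le_dyadic_control;
      rewrite // ?ale ?an.
  rewrite -mulr_sumr ler_wpM2l ?powR_ge0//.
  apply: (le_trans (superadditive_sum_le F (fun i => dyadic s h n (a i)) N _ _ _)).
  - by move=> *; exact: dyadic_control_superadditive.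
  - by move=> *; exact: dyadic_control_ge0.
  - by move=> i iN; rewrite dyadic_le ?ale// ltW.
  apply: ler_sum => j _; rewrite ler_wpM2l ?powR_ge0// dyadic_sum_le//.
    by have := dyadic_le s h n 0 (a 0) (ltW h0) (leq0n _); rewrite dyadic0.
  by rewrite -(dyadic_max s h n) dyadic_le ?an// ltW.
have F_le : F s (s + h) <= (B / (1 - rho)) `^ r.
  rewrite (@le_trans _ _ (\sum_(j < n.+1) B `^ r * rho ^+ j))//.
    apply: ler_sum => j _; have rj0 : 0 < rho ^+ j by rewrite exprn_gt0.
    rewrite powRN mulrC ler_pdivrMr ?powR_gt0//; apply: (le_trans (HM j)).
    rewrite -addnn exprD mulrA powRM ?mulr_ge0 ?(ltW rj0)//.
    rewrite ler_wpM2r ?powR_ge0// powRM ?(ltW rj0)// ler_wpM2l ?powR_ge0//.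
    by apply: ge1r_powR; rewrite // rj0 exprn_ile1// ltW.
  rewrite -mulr_sumr powRM// ?invr_ge0 ?(ltW d0)// ler_wpM2l ?powR_ge0//.
  apply: (le_trans (sum_expr_le _ _ rho0 rho1)).
  by apply: le1r_powR; rewrite // invf_ge1// gerBl ltW.
rewrite (le_trans (ler_wpM2l (powR_ge0 _ _) F_le))//.
rewrite -powRM// ?divr_ge0// ?(ltW d0)//.
by rewrite expr2 invfM mulrACA !mulrA.
Qed.

Lemma dyadic_floor {R : realType} (s h x : R) : 0 < h -> s <= x ->
  (fun n => dyadic s h n (Num.truncn ((x - s) * 2 ^+ n / h))) @ \oo --> x.
Proof.
move=> h0 sx.
have lo n : x - h / 2 ^+ n <= dyadic s h n (Num.truncn ((x - s) * 2 ^+ n / h)) <= x.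
  have z0 : 0 <= (x - s) * 2 ^+ n / h by rewrite divr_ge0 ?mulr_ge0 ?subr_ge0 ?exprn_ge0// ltW.
  have := truncn_itv z0; set m := Num.truncn _ => /andP[m1 m2].
  have e0 : 0 < (2 : R) ^+ n by rewrite exprn_gt0.
  move: m1; rewrite ler_pdivlMr// -ler_pdivrMr// lerBrDl => m1.
  move: m2; rewrite ltr_pdivrMr// -ltr_pdivlMr// ltrBlDl => m2.
  apply/andP; split; last by rewrite /dyadic (mulrC h).
  rewrite /dyadic lerBlDr -addrA -mulrDl ltW//.
  by rewrite (_ : h * m%:R + h = m.+1%:R * h)// -natr1 mulrDl mul1r mulrC.
apply: (squeeze_cvgr (f := fun n => x - h / 2 ^+ n) (h := fun=> x)).
- by apply: nearW.
- rewrite -[X in _ --> X]subr0; apply: cvgB; first exact: cvg_cst.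
  exact: cvg_div_exp2.
- exact: cvg_cst.
Qed.

(** * The r-variation on one interval *)

Lemma within_continuous_cvg {X Y : topologicalType} (A : set X) (f : X -> Y)
    (u : nat -> X) (x : X) :
  {within A, continuous f} -> A x -> (forall n, A (u n)) -> u @ \oo --> x ->
  (f \o u) @ \oo --> f x.
Proof.
move=> /subspace_continuousP cf Ax Au ux W /(cf _ Ax) WA.
have : \forall n \near \oo, A (u n) -> W (f (u n)) by exact: ux WA.
by apply: filterS => n /(_ (Au n)).
Qed.

(** Continuity and subadditivity do not force chi (x, x) = 0, and partitions
    never see the diagonal. Setting chi to 0 there preserves subadditivity. *)
Definition off_diagonal {R : realType} (chi : R * R -> R) (x y : R) : R :=
  if x < y then chi (x, y) else 0.

Lemma interval_subadditive_off_diagonal {R : realType} (T s h : R) (chi : R * R -> R) :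
  (forall st, Delta T st -> 0 <= chi st) -> subadditive_on T chi ->
  0 <= s -> s + h <= T -> interval_subadditive (off_diagonal chi) s (s + h).
Proof.
move=> chi0 chiS s0 shT; split => [x y sx xy ysh|x|x y z sx xy yz zsh].
- rewrite /off_diagonal; case: ifP => // _; apply: chi0.
  by split; [exact: (le_trans s0 sx)|split=> //=; exact: (le_trans ysh)].
- by rewrite /off_diagonal ltxx.
- have := chiS x y z (le_trans s0 sx) xy yz (le_trans zsh shT).
  rewrite /off_diagonal; move: xy yz; rewrite 2!le_eqVlt.
  move=> /predU1P[<-|xy] /predU1P[<-|yz]; rewrite ?ltxx ?add0r ?addr0//.
  by rewrite xy yz (lt_trans xy yz).
Qed.

Lemma dyadic_sum_off_diagonal {R : realType} (r s h : R) (chi : R * R -> R) j : 0 < h ->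
  dyadic_sum r (off_diagonal chi) s h j s (s + h) =
  \sum_(i < 2 ^ j) chi (dyadic s h j i, dyadic s h j i.+1) `^ r.
Proof.
move=> h0; rewrite /dyadic_sum; apply: eq_big => [i|i _].
  apply/andP; split.
    by have := dyadic_le s h j 0 i (ltW h0) (leq0n i); rewrite dyadic0.
  by rewrite -(dyadic_max s h j) dyadic_le ?(ltW h0)// ltn_ord.
by rewrite /off_diagonal dyadic_lt.
Qed.

(** The deterministic core: decay of the dyadic sums of chi ^ r along the levels
    bounds the r-variation over all partitions. Level 0 is not assumed, since
    by subadditivity it is controlled by level 1. Thus only the modulus of chi at
    times up to T / 2 will enter, which the Besov norm bounds directly. *)
Lemma rvariation_le {R : realType} (T r rho B s h : R) (chi : R * R -> R) :
  1 <= r -> 0 < rho -> rho < 1 -> 0 <= B -> 0 <= s -> 0 < h -> s + h <= T ->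
  {within Delta T, continuous chi} ->
  (forall st, Delta T st -> 0 <= chi st) -> subadditive_on T chi ->
  (forall j, (0 < j)%N ->
    \sum_(i < 2 ^ j) chi (dyadic s h j i, dyadic s h j i.+1) `^ r <=
    (B * rho ^+ j.*2) `^ r) ->
  (rvariation r (EFin \o chi) (s, s + h)%R <= (4 * B / (1 - rho) ^+ 2)%:E)%E.
Proof.
move=> r1 rho0 rho1 B0 s0 h0 shT cchi chi0 chiS HM.
have r0 : 0 < r by rewrite (lt_le_trans _ r1).
have d0 : 0 < 1 - rho by rewrite subr_gt0.
set f := off_diagonal chi.
have fS : interval_subadditive f s (s + h) by exact: (interval_subadditive_off_diagonal T).
have M j : dyadic_sum r f s h j s (s + h) <= (2 * B * rho ^+ j.*2) `^ r.
  have Bj k : 0 <= B * rho ^+ k by rewrite mulr_ge0// exprn_ge0// ltW.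
  rewrite dyadic_sum_off_diagonal//; case: j => [|j]; last first.
    apply: (le_trans (HM j.+1 isT)); rewrite -mulrA.
    apply: ge0_ler_powR; rewrite ?nnegrE ?(ltW r0) ?Bj//; first by rewrite mulr_ge0 ?Bj.
    by rewrite ler_peMl ?ler1n ?Bj.
  rewrite expn0 big_ord1 expr0 mulr1; have := HM 1 isT.
  rewrite expn1 big_ord_recr big_ord1/= (dyadicS s h 0 1) !dyadic0 => H1.
  have s_mid : s <= dyadic s h 1 1 by rewrite -[leLHS](dyadic0 s h 1) dyadic_le// ltW.
  have mid_e : dyadic s h 1 1 <= s + h.
    by rewrite -(dyadic_max s h 1) dyadic_le// ltW.
  have e_E : dyadic s h 0 1 = s + h by rewrite -(dyadic_max s h 0).
  have D1 : Delta T (s, dyadic s h 1 1) by split=> //=; split=> //; exact: (le_trans mid_e).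
  have D2 : Delta T (dyadic s h 1 1, s + h) by split=> /=; [exact: (le_trans s0)|].
  have D3 : Delta T (s, s + h) by split=> //=; split=> //; rewrite lerDl ltW.
  have B1 x : Delta T x -> chi x `^ r <= (B * rho ^+ 2) `^ r -> chi x <= B.
    move=> Dx le_x; rewrite (@le_trans _ _ (B * rho ^+ 2))//.
      rewrite leNgt; apply/negP => lt_x; move: le_x; rewrite leNgt => /negP; apply.
      by apply: gt0_ltr_powR; rewrite // ?nnegrE ?chi0.
    by rewrite ler_piMr// exprn_ile1// ltW.
  have b1 : chi (s, dyadic s h 1 1) <= B.
    by apply: B1 => //; rewrite (le_trans _ H1)// lerDl powR_ge0.
  have b2 : chi (dyadic s h 1 1, s + h) <= B.
    by apply: B1 => //; rewrite -e_E (le_trans _ H1)// lerDr powR_ge0.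
  rewrite e_E; apply: ge0_ler_powR; rewrite ?nnegrE ?(ltW r0) ?mulr_ge0 ?chi0//.
  by have := chiS _ _ _ s0 s_mid mid_e shT; lra.
have K0 : 0 <= 4 * B / (1 - rho) ^+ 2 by rewrite divr_ge0 ?mulr_ge0 ?exprn_ge0// ltW.
apply: ge_ereal_sup => _ [pi [pi_sorted pi_in] <-].
set N := (size pi).-1; pose x i := nth 0 pi i.
have x_lt i : (i < N)%N -> x i < x i.+1.
  by move=> iN; apply: (sortedP 0 pi_sorted); rewrite -ltn_predRL.
have x_in i : (i <= N)%N -> (0 < N)%N -> s <= x i /\ x i <= s + h.
  move=> iN N0; apply: pi_in; apply: mem_nth.
  by rewrite (leq_ltn_trans iN)// ltn_predL (leq_trans N0)// leq_pred.
rewrite /partition_sum -/N.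
under eq_bigr => i _ do rewrite /= -/(x i) -/(x i.+1).
rewrite sumEFin poweR_EFin lee_fin.
rewrite -[leRHS](powRK r)//.
apply: ge0_ler_powR; rewrite ?nnegrE ?invr_ge0 ?(ltW r0) ?powR_ge0//.
  by apply: sumr_ge0 => i _; exact: powR_ge0.
case: (posnP N) => [->|N0]; first by rewrite big_ord0 powR_ge0.
(* Round every point of the partition down to the grid of level n. *)
pose a n i := Num.truncn ((x i - s) * 2 ^+ n / h).
have a_lo n i : (i <= N)%N -> s <= dyadic s h n (a n i).
  by move=> _; rewrite -[leLHS](dyadic0 s h n) dyadic_le// ltW.
have a_le n i : (i < N)%N -> (a n i <= a n i.+1)%N.
  move=> iN; apply: le_truncn; rewrite ler_pM2r ?invr_gt0// ler_pM2r ?exprn_gt0//.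
  by rewrite lerB// ltW// x_lt.
have a_max n i : (i <= N)%N -> (a n i <= 2 ^ n)%N.
  move=> iN; rewrite truncn_le_nat; have [_ xe] := x_in i iN N0.
  rewrite (@le_lt_trans _ _ (2 ^ n)%:R) ?ltr_nat// natrX ler_pdivrMr//.
  by rewrite mulrC ler_pM2l ?exprn_gt0// lerBlDl.
have cv (i : 'I_N) : (fun n => chi (dyadic s h n (a n i), dyadic s h n (a n i.+1)))
    @ \oo --> chi (x i, x i.+1).
  have [sx xe] := x_in i (ltnW (ltn_ord i)) N0.
  have [sx' xe'] := x_in i.+1 (ltn_ord i) N0.
  apply: (within_continuous_cvg (Delta T) chi
    (fun n => (dyadic s h n (a n i), dyadic s h n (a n i.+1))) (x i, x i.+1)) => //.
  - do !split => /=; first exact: le_trans sx.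
      by apply/ltW/x_lt.
    exact: le_trans shT.
  - move=> n; do !split => /=; first exact: (le_trans s0 (a_lo _ _ (ltnW (ltn_ord i)))).
      by rewrite dyadic_le ?(ltW h0)// a_le.
    by rewrite (le_trans _ shT)// -(dyadic_max s h n) dyadic_le ?(ltW h0)// a_max.
  - exact: cvg_pair (dyadic_floor s h _ h0 sx) (dyadic_floor s h _ h0 sx').
have chi_ge0 (i : 'I_N) : 0 <= chi (x i, x i.+1).
  have [sx xe] := x_in i (ltnW (ltn_ord i)) N0.
  have [sx' xe'] := x_in i.+1 (ltn_ord i) N0.
  apply: chi0; do !split => /=; first exact: le_trans sx.
    by apply/ltW/x_lt.
  exact: le_trans shT.
set S := \sum_(i < N) _; have S0 : 0 <= S by apply: sumr_ge0 => i _; exact: powR_ge0.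
set K := 4 * B / _ in K0 *; pose Y := S `^ r^-1.
have YE : Y `^ r = S by rewrite powRVK.
rewrite -YE; apply: ge0_ler_powR; rewrite ?nnegrE ?powR_ge0 ?(ltW r0)//.
rewrite leNgt; apply/negP => KY.
have Y0 : 0 < Y := le_lt_trans K0 KY.
(* For large n each rounded increment is at least l times the original, where
   the factor l < 1 is so close to 1 that l * Y > K still holds. *)
pose l := (K + Y) / (2 * Y).
have lY : l * Y = (K + Y) / 2 by rewrite /l invfM mulrA mulfVK ?gt_eqF.
have l1 : l < 1 by rewrite ltr_pdivrMr ?mulr_gt0// mul1r mulrDl mul1r ltrD2r.
have l0 : 0 <= l by rewrite divr_ge0 ?mulr_ge0 ?addr_ge0// ltW.
have ev (i : 'I_N) : \forall n \near \oo, l * chi (x i, x i.+1) <=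
    f (dyadic s h n (a n i)) (dyadic s h n (a n i.+1)).
  have [chi_i0|chi_i0] := eqVneq (chi (x i, x i.+1)) 0.
    apply: nearW => n; rewrite chi_i0 mulr0; case: fS => f0 _ _; apply: f0.
    - exact: (a_lo n i (ltnW (ltn_ord i))).
    - by rewrite dyadic_le ?(ltW h0)// a_le.
    - by rewrite -(dyadic_max s h n) dyadic_le ?(ltW h0)// a_max.
  have [sx xe] := x_in i (ltnW (ltn_ord i)) N0.
  have [sx' xe'] := x_in i.+1 (ltn_ord i) N0.
  have m1 : x i < (x i + x i.+1) / 2 by have := x_lt i (ltn_ord i); lra.
  have m2 : (x i + x i.+1) / 2 < x i.+1 by have := x_lt i (ltn_ord i); lra.
  have lt_chi : l * chi (x i, x i.+1) < chi (x i, x i.+1).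
    by rewrite gtr_pMl// lt_def chi_i0 chi_ge0.
  have n1 := cvgr_lt _ (dyadic_floor s h _ h0 sx) _ m1.
  have n2 := cvgr_gt _ (dyadic_floor s h _ h0 sx') _ m2.
  have n3 := cvgr_gt _ (cv i) _ lt_chi.
  near=> n; rewrite /f /off_diagonal ifT.
    by apply: ltW; near: n; exact: n3.
  by apply: (@lt_trans _ _ ((x i + x i.+1) / 2)); near: n; [exact: n1|exact: n2].
have [n nP] : exists n, forall i : 'I_N, l * chi (x i, x i.+1) <=
    f (dyadic s h n (a n i)) (dyadic s h n (a n i.+1)).
  have /filter_ex[n nP] : \forall n \near \oo, forall i : 'I_N, l * chi (x i, x i.+1) <=
    f (dyadic s h n (a n i)) (dyadic s h n (a n i.+1)) by exact: filter_forall.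
  by exists n.
have B2 : 0 <= 2 * B by rewrite mulr_ge0.
have := dyadic_partition_le r rho (2 * B) f s h n N (a n) r1 rho0 rho1 h0 B2 fS M
  (a_le n) (a_max n).
rewrite mulrA -natrM -/K; apply/negP; rewrite -ltNge.
have : K < l * Y by rewrite lY; lra.
move/(gt0_ltr_powR r0 _ _); rewrite !nnegrE => /(_ K0 (mulr_ge0 l0 (ltW Y0))).
move=> /lt_le_trans; apply.
rewrite powRM ?(ltW Y0)// YE mulr_sumr; apply: ler_sum => i _.
by rewrite -powRM//; apply: ler_powRl; rewrite ?(mulr_ge0 l0)//; exact: nP.
Unshelve. all: by end_near. Qed.

(** * The L^p norm of the increments of the r-variation *)

Definition increment {R : realType} (T : R) (chi : R * R -> \bar R) (h : R) : R -> \bar R :=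
  (fun s => chi (s, s + h)) \_ `[0, T - h].

Lemma increment_normE {R : realType} (T : R) p (chi : R * R -> \bar R) h :
  increment_norm T p chi h = Lnorm (@lebesgue_measure R) p (increment T chi h).
Proof. by []. Qed.

Lemma measurable_increment {R : realType} (T h : R) (chi : R * R -> R) :
  {within Delta T, continuous chi} -> 0 <= h ->
  measurable_fun [set: R] (increment T (EFin \o chi) h).
Proof.
move=> cchi h0.
apply/(measurable_restrictT _ _).1 => //.
apply/measurable_EFinP.
apply: subspace_continuous_measurable_fun => //.
apply/subspace_continuousP => x /=; rewrite in_itv/= => /andP[x0 xT] W.
move/subspace_continuousP: cchi => /(_ (x, x + h)) cx.
have /cx {}cx : Delta T (x, x + h) by do !split => //=; [rewrite lerDl|rewrite -lerBrDr].
move/cx => WA.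
have cy : (fun y : R => y + h) @ x --> x + h.
  by apply: (@cvgD _ R^o); [exact: cvg_id|exact: cvg_cst].
have : \forall y \near x, Delta T (y, y + h) -> W (chi (y, y + h)).
  exact: (cvg_pair (@cvg_id _ (nbhs x)) cy WA).
apply: filterS => y Wy /=; rewrite in_itv/= => /andP[y0 yT].
by apply: Wy; do !split => //=; [rewrite lerDl|rewrite -lerBrDr].
Qed.

Lemma rvariation_ge0 {R : realType} (r : R) (chi : R * R -> \bar R) st : 1 <= r ->
  (0 <= rvariation r chi st)%E.
Proof.
move=> r1; apply: ereal_sup_ubound; exists [::]; first by split.
rewrite /partition_sum big_ord0 poweR0r// invr_neq0// gt_eqF//.
exact: lt_le_trans r1.
Qed.

Lemma increment_ge0 {R : realType} (T : R) (chi : R * R -> \bar R) h s :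
  (forall x, 0 <= x -> x <= T - h -> (0 <= chi (x, (x + h)%R))%E) ->
  (0 <= increment T chi h s)%E.
Proof.
move=> chi0; rewrite /increment patchE; case: ifPn => // /set_mem/=.
by rewrite in_itv/= => /andP[s0 sT]; exact: chi0.
Qed.

Lemma increment_dyadic {R : realType} (T h s : R) (chi : R * R -> R) j i :
  0 < h -> 0 <= s -> s <= T - h -> (i < 2 ^ j)%N ->
  increment T (EFin \o chi) (h / 2 ^+ j) (translation (h * i%:R / 2 ^+ j) s) =
  (chi (dyadic s h j i, dyadic s h j i.+1))%:E.
Proof.
move=> h0 s0 sT ij.
have E : translation (h * i%:R / 2 ^+ j) s + h / 2 ^+ j = dyadic s h j i.+1.
  by rewrite /translation /dyadic -addrA -mulrDl -[i.+1%:R]natr1 mulrDr mulr1.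
rewrite /increment patchE ifT ?E// inE/= in_itv/=; apply/andP; split.
  by rewrite addr_ge0// divr_ge0 ?exprn_ge0// mulr_ge0// ltW.
rewrite lerBrDr E (@le_trans _ _ (s + h)) -?lerBrDr//.
by rewrite lerBrDr -(dyadic_max s h j) dyadic_le// ltW.
Qed.

Section increment_bound.
Context {R : realType} (T r rho h : R) (chi : R * R -> R).
Hypotheses (r1 : 1 <= r) (rho0 : 0 < rho) (rho1 : rho < 1) (h0 : 0 < h).
Hypotheses (cchi : {within Delta T, continuous chi})
  (chi0 : forall st, Delta T st -> 0 <= chi st) (chiS : subadditive_on T chi).

Let w : R := 2 `^ (- r^-1).
Let V := rvariation r (EFin \o chi).
Let r0 : 0 < r := lt_le_trans ltr01 r1.

Let w0 : 0 < w. Proof. exact: powR_gt0. Qed.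

Let w_r m : (w ^+ m) `^ r = (2 ^+ m)^-1.
Proof.
by rewrite powR_expr ?ltW// /w -powRrM mulNr mulVf ?gt_eqF// powR_inv1// exprVn.
Qed.

Lemma increment_dyadic_ge0 m s :
  (0 <= increment T (EFin \o chi) (h / 2 ^+ m) s)%E.
Proof.
apply: increment_ge0 => x x0 xT; rewrite lee_fin; apply: chi0; do !split => //=.
  by rewrite lerDl divr_ge0 ?exprn_ge0// ltW.
by rewrite -lerBrDr.
Qed.

Let chi_dyadic_ge0 s j i : 0 <= s -> s <= T - h -> (i < 2 ^ j)%N ->
  0 <= chi (dyadic s h j i, dyadic s h j i.+1).
Proof.
by move=> s0 sT ij; rewrite -lee_fin -(increment_dyadic T)// increment_dyadic_ge0.
Qed.

Let C : R := 4 / (1 - rho) ^+ 2.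
Let C0 : 0 < C. Proof. by rewrite divr_gt0// exprn_gt0// subr_gt0. Qed.

Lemma increment_rvariation_le (B s : R) : 0 <= B ->
  (0 <= s -> s <= T - h -> forall j, (0 < j)%N ->
    \sum_(i < 2 ^ j) chi (dyadic s h j i, dyadic s h j i.+1) `^ r <=
    (B * rho ^+ j.*2) `^ r) ->
  (increment T V h s <= (C * B)%:E)%E.
Proof.
move=> B0 HM; rewrite /increment patchE; case: ifPn => [|_]; last first.
  by rewrite lee_fin mulr_ge0// ltW.
move=> /set_mem/=; rewrite in_itv/= => /andP[s0 sT].
rewrite (le_trans (rvariation_le T r rho B _ _ chi _ _ _ _ _ _ _ _ _ _ _))//.
- by rewrite -lerBrDr.
- exact: HM.
- by rewrite lee_fin /C mulrAC.
Qed.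

Section finite_p.
Variable p : R.
Hypothesis rp : r <= p.
Let p0 : 0 < p := lt_le_trans r0 rp.
Let lam m : R := rho ^+ m.*2 * w ^+ m / 2.
Let lam0 m : 0 < lam m.
Proof. by rewrite /lam divr_gt0// mulr_gt0// exprn_gt0. Qed.

(** The weights are such that, if the value at s is B ^ p, then the level-j
    increments satisfy the hypothesis of power_mean_le with
    l = B * rho ^ (2 j) * 2 ^ (- j / r) / 2, for every j >= 1. *)
Definition dyadic_series (s : R) : \bar R :=
  (\sum_(j <oo) ((2 ^+ j.+1 * (rho ^+ j.+1.*2 * (2 `^ (- r^-1)) ^+ j.+1 / 2) `^ p)^-1)%:E *
    \sum_(i < 2 ^ j.+1) increment T (EFin \o chi) (h / 2 ^+ j.+1)
       (translation (h * i%:R / 2 ^+ j.+1) s) `^ p)%E.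

Lemma dyadic_series_ge0 s : (0 <= dyadic_series s)%E.
Proof.
apply: nneseries_ge0 => j _ _; rewrite mule_ge0 ?sume_ge0//.
  by rewrite lee_fin invr_ge0 mulr_ge0 ?powR_ge0.
by move=> i _; exact: poweR_ge0.
Qed.

(** Here r <= p enters: by comparison of power means, a bound on sums of p-th
    powers over the 2 ^ j intervals of level j gives one on sums of r-th
    powers. *)
Lemma increment_rvariation_le_series s :
  (increment T V h s <= C%:E * dyadic_series s `^ p^-1)%E.
Proof.
have S0 := dyadic_series_ge0 s.
have [Sy|Sy] := eqVneq (dyadic_series s) +oo%E.
  by rewrite Sy poweRyr ?invr_eq0 ?gt_eqF// gt0_muley ?lte_fin// leey.
have Sfin : dyadic_series s \is a fin_num by rewrite ge0_fin_numE// lt_neqAle Sy leey.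
have [b bE] : exists b, dyadic_series s = b%:E by exists (fine (dyadic_series s)); rewrite fineK.
have b0 : 0 <= b by rewrite -lee_fin -bE.
rewrite bE poweR_EFin -EFinM; apply: increment_rvariation_le; first exact: powR_ge0.
move=> s0 sT [//|j] _; set m := j.+1.
have xp : \sum_(i < 2 ^ m) chi (dyadic s h m i, dyadic s h m i.+1) `^ p <=
    (2 ^ m)%:R * (lam m * b `^ p^-1) `^ p.
  rewrite powRM ?powR_ge0 ?(ltW (lam0 m))// powRVK// natrX mulrA -ler_pdivrMl; last first.
    by rewrite mulr_gt0 ?powR_gt0 ?exprn_gt0.
  rewrite -lee_fin -bE EFinM -sumEFin.
  under eq_bigr => i _ do rewrite -poweR_EFin -(increment_dyadic T)//.
  rewrite /dyadic_series (le_trans _ (nneseries_lim_ge m _))//; last first.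
    move=> k _ _; rewrite mule_ge0 ?sume_ge0//.
      by rewrite lee_fin invr_ge0 mulr_ge0 ?powR_ge0.
    by move=> i _; exact: poweR_ge0.
  rewrite big_nat_recr//= leeDr// sume_ge0// => k _; rewrite mule_ge0 ?sume_ge0//.
    by rewrite lee_fin invr_ge0 mulr_ge0 ?powR_ge0.
  by move=> i _; exact: poweR_ge0.
have := power_mean_le r p (lam m * b `^ p^-1) (2 ^ m)
  (fun i => chi (dyadic s h m i, dyadic s h m i.+1)) r0 rp.
rewrite mulr_ge0 ?powR_ge0 ?(ltW (lam0 m))// => /(_ isT) => /(_ (fun i => chi_dyadic_ge0 s m i s0 sT) xp).
move=> /le_trans; apply.
have rm0 : 0 <= rho ^+ m.*2 by rewrite exprn_ge0// ltW.
have wm0 : 0 <= w ^+ m by rewrite exprn_ge0// ltW.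
have lamr : lam m `^ r = (rho ^+ m.*2) `^ r * (2 ^+ m)^-1 * 2^-1 `^ r.
  by rewrite /lam powRM ?(mulr_ge0 rm0 wm0) ?invr_ge0// powRM// w_r.
rewrite powRM ?(ltW (lam0 m)) ?powR_ge0// lamr natrX [leRHS]powRM ?powR_ge0//.
(* The factor 1 / 2 in the weights absorbs the factor 2 of power_mean_le. *)
have half_r : 2 * 2^-1 `^ r <= 1 :> R.
  rewrite -ler_pdivlMl// mulr1.
  by apply: ge1r_powR; rewrite // invr_gt0 ltr0n/= invf_le1// ler1n.
have e0 : (2 : R) ^+ m != 0 by rewrite expf_neq0.
move: e0 half_r (powR_ge0 (b `^ p^-1) r) (powR_ge0 (rho ^+ m.*2) r).
set e := 2 ^+ m; set X := 2^-1 `^ r; set Y := _ `^ r; set Z := _ `^ r => e0 X1 Y0 Z0.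
have -> : 2 * e * (Z * e^-1 * X * Y) = (2 * X) * (Y * Z) by field.
by rewrite ler_piMl// mulr_ge0.
Qed.

End finite_p.
End increment_bound.

(** By translation invariance the 2 ^ j shifted increments of step h / 2 ^ j all
    have the same integral. *)
Lemma integral_dyadic_series {R : realType} (T r rho h : R) (chi : R * R -> R) (p : R) :
  0 < rho -> 0 < h -> {within Delta T, continuous chi} ->
  (forall st, Delta T st -> 0 <= chi st) ->
  (\int[@lebesgue_measure R]_s dyadic_series T r rho h chi p s =
   \sum_(j <oo) ((rho ^+ j.+1.*2 * (2 `^ (- r^-1)) ^+ j.+1 / 2) `^ p)^-1%:E *
     \int[@lebesgue_measure R]_s increment T (EFin \o chi) (h / 2 ^+ j.+1) s `^ p)%E.
Proof.
move=> rho0 h0 cchi chi0.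
have mterm j c : measurable_fun [set: R]
    (fun s => increment T (EFin \o chi) (h / 2 ^+ j) (translation c s) `^ p)%E.
  apply: (measurableT_comp (measurable_poweR _)) => //.
  apply: measurableT_comp; last exact: measurable_translation.
  by apply: measurable_increment; rewrite // divr_ge0 ?exprn_ge0// ltW.
have k0 j : 0 <= (2 ^+ j.+1 * (rho ^+ j.+1.*2 * 2 `^ (- r^-1) ^+ j.+1 / 2) `^ p)^-1.
  by rewrite invr_ge0 mulr_ge0 ?powR_ge0 ?exprn_ge0.
rewrite integral_nneseries//; last 2 first.
- by move=> j; apply: measurable_funeM; apply: emeasurable_sum => i; exact: mterm.
- move=> j x _; rewrite mule_ge0 ?lee_fin ?k0// sume_ge0// => i _; exact: poweR_ge0.
apply: eq_eseriesr => j _.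
rewrite ge0_integralZl_EFin//; last 2 first.
- by move=> x _; rewrite sume_ge0// => i _; exact: poweR_ge0.
- by apply: emeasurable_sum => i; exact: mterm.
rewrite ge0_integral_sum//; last 2 first.
- by move=> i; exact: mterm.
- by move=> i x _; exact: poweR_ge0.
rewrite (eq_bigr (fun=> (\int[@lebesgue_measure R]_s
    increment T (EFin \o chi) (h / 2 ^+ j.+1) s `^ p)%E)); last first.
  move=> i _; apply: (ge0_integral_translation _
    (fun s => increment T (EFin \o chi) (h / 2 ^+ j.+1) s `^ p)%E) => [|x].
    apply: (measurableT_comp (measurable_poweR _)) => //.
    by apply: measurable_increment; rewrite // divr_ge0 ?exprn_ge0// ltW.
  exact: poweR_ge0.
rewrite sume_const; last by apply: integral_ge0 => x _; exact: poweR_ge0.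
rewrite muleA -EFinM natrX.
rewrite invfM mulrAC mulVf ?mul1r// expf_neq0//.
Qed.

Lemma measurable_dyadic_series {R : realType} (T r rho h : R) (chi : R * R -> R) (p : R) :
  0 < rho -> 0 < h -> {within Delta T, continuous chi} ->
  measurable_fun [set: R] (dyadic_series T r rho h chi p).
Proof.
move=> rho0 h0 cchi.
have k0 j : 0 <= (2 ^+ j.+1 * (rho ^+ j.+1.*2 * 2 `^ (- r^-1) ^+ j.+1 / 2) `^ p)^-1.
  by rewrite invr_ge0 mulr_ge0 ?powR_ge0 ?exprn_ge0.
apply: ge0_emeasurable_sum => [j x _ _|j _].
  by rewrite mule_ge0 ?lee_fin ?k0// sume_ge0// => i _; exact: poweR_ge0.
apply: measurable_funeM; apply: emeasurable_sum => i.
apply: (measurableT_comp (measurable_poweR _)) => //.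
apply: measurableT_comp; last exact: measurable_translation.
by apply: measurable_increment; rewrite // divr_ge0 ?exprn_ge0// ltW.
Qed.

(** The increments of step h / 2 ^ j are sampled at 2 ^ j points, which costs
    2 ^ (j / r) after comparison of power means; a decay of their norm faster
    than 2 ^ (- j / r), namely by the additional factor rho ^ (3 j), leaves
    a convergent series. *)
Lemma increment_norm_rvariation_le_fin {R : realType} (T r rho h p G : R) (chi : R * R -> R) :
  1 <= r -> 0 < rho -> rho < 1 -> r <= p -> 0 < h -> 0 <= G ->
  {within Delta T, continuous chi} ->
  (forall st, Delta T st -> 0 <= chi st) -> subadditive_on T chi ->
  (forall j, (increment_norm T p%:E (EFin \o chi) (h / 2 ^+ j.+1) <=
     ((rho ^+ 3 * 2 `^ (- r^-1)) ^+ j.+1 * G)%:E)%E) ->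
  (increment_norm T p%:E (rvariation r (EFin \o chi)) h <= (8 / (1 - rho) ^+ 3 * G)%:E)%E.
Proof.
move=> r1 rho0 rho1 rp h0 G0 cchi chi0 chiS HG.
have r0 : 0 < r := lt_le_trans ltr01 r1.
have p0 : 0 < p := lt_le_trans r0 rp.
have p1 : 1 <= p := le_trans r1 rp.
have d0 : 0 < 1 - rho by rewrite subr_gt0.
have w0 : 0 < (2 : R) `^ (- r^-1) by rewrite powR_gt0.
set V := rvariation r (EFin \o chi).
set S := dyadic_series T r rho h chi p.
have S0 s : (0 <= S s)%E by exact: dyadic_series_ge0.
have incV0 s : (0 <= increment T V h s)%E.
  by apply: increment_ge0 => *; exact: rvariation_ge0.
pose C : R := 4 / (1 - rho) ^+ 2.
have C0 : 0 <= C by rewrite divr_ge0// exprn_ge0// ltW.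
have intS : (\int[@lebesgue_measure R]_s S s <= ((2 * G / (1 - rho)) `^ p)%:E)%E.
  rewrite integral_dyadic_series//.
  apply: (@le_trans _ _ (\sum_(j <oo) ((2 * G) `^ p * rho ^+ j)%:E)%E); last first.
    apply: (le_trans (nneseries_geometric_le _ _ rho0 rho1 (powR_ge0 _ _))).
    rewrite lee_fin [leRHS]powRM ?mulr_ge0 ?invr_ge0 ?(ltW d0)//.
    rewrite ler_wpM2l ?powR_ge0//.
    by apply: le1r_powR; rewrite // invf_ge1// gerBl ltW.
  apply: lee_nneseries => [j _ _|j _].
    rewrite mule_ge0 ?lee_fin ?invr_ge0 ?powR_ge0//.
    by apply: integral_ge0 => s _; exact: poweR_ge0.
  set m := j.+1; set lam := rho ^+ m.*2 * _ / 2.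
  have lam0 : 0 < lam by rewrite /lam; apply: divr_gt0 => //; apply: mulr_gt0; exact: exprn_gt0.
  have inc_le : (\int[@lebesgue_measure R]_s increment T (EFin \o chi) (h / 2 ^+ m) s `^ p <=
      (((rho ^+ 3 * 2 `^ (- r^-1)) ^+ m * G) `^ p)%:E)%E.
    rewrite -poweR_EFin (le_trans _ (le_poweR _ _ _ (ltW p0) _ (HG j)))//; last exact: Lnorm_ge0.
    rewrite increment_normE poweR_Lnorm ?gt_eqF//.
    rewrite le_eqVlt; apply/orP; left; apply/eqP; apply: eq_integral => s _.
    by rewrite gee0_abs// increment_dyadic_ge0.
  apply: (le_trans (lee_wpmul2l _ inc_le)); first by rewrite lee_fin invr_ge0 powR_ge0.
  rewrite -EFinM lee_fin mulrC ler_pdivrMr ?powR_gt0//.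
  have -> : (rho ^+ 3 * 2 `^ (- r^-1)) ^+ m * G = (2 * G) * rho ^+ m * lam.
    by rewrite /lam expr3M; field.
  have G2 : 0 <= 2 * G by rewrite mulr_ge0.
  have rm0 : 0 <= rho ^+ m by rewrite exprn_ge0// ltW.
  rewrite [leLHS]powRM ?(mulr_ge0 G2 rm0) ?(ltW lam0)// ler_wpM2r ?powR_ge0//.
  rewrite [leLHS]powRM// ler_wpM2l ?powR_ge0//.
  rewrite (@le_trans _ _ (rho ^+ m))//.
    by apply: ge1r_powR; rewrite // exprn_gt0// exprn_ile1// ltW.
  by rewrite exprS ler_piMl ?exprn_ge0// ltW.
have intV : (\int[@lebesgue_measure R]_s `|increment T V h s| `^ p <=
    ((C * (2 * G / (1 - rho))) `^ p)%:E)%E.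
  apply: (@le_trans _ _ (\int[@lebesgue_measure R]_s ((C `^ p)%:E * S s))%E).
    apply: ge0_le_integralT => s; first exact: poweR_ge0.
    rewrite gee0_abs//.
    rewrite (le_trans (le_poweR _ _ _ (ltW p0) (incV0 s)
      (increment_rvariation_le_series T r rho h chi r1 rho0 rho1 h0 cchi chi0 chiS p rp s)))//.
    by rewrite poweRM ?lee_fin ?poweR_ge0// poweRVK.
  rewrite ge0_integralZl_EFin ?powR_ge0//; last exact: measurable_dyadic_series.
  have q0 : 0 <= 2 * G / (1 - rho) by rewrite divr_ge0 ?mulr_ge0// ltW.
  rewrite (@powRM _ C (2 * G / (1 - rho)) p C0 q0).
  by rewrite EFinM lee_wpmul2l// lee_fin powR_ge0.
rewrite increment_normE unlock.
rewrite (le_trans (le_poweR _ _ _ _ _ intV))// ?invr_ge0 ?(ltW p0)//.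
  by apply: integral_ge0 => s _; exact: poweR_ge0.
have D0 : 0 <= C * (2 * G / (1 - rho)) by apply: mulr_ge0 => //; rewrite divr_ge0 ?mulr_ge0// ltW.
rewrite poweR_EFin powRK// lee_fin /C le_eqVlt; apply/orP; left; apply/eqP.
by field; rewrite gt_eqF.
Qed.

(** For almost every s all countably many increments that occur in the dyadic
    sums of [s, s + h] are bounded by their essential suprema. *)
Lemma increment_norm_rvariation_le_pinfty {R : realType} (T r rho h G : R) (chi : R * R -> R) :
  1 <= r -> 0 < rho -> rho < 1 -> 0 < h -> 0 <= G ->
  {within Delta T, continuous chi} ->
  (forall st, Delta T st -> 0 <= chi st) -> subadditive_on T chi ->
  (forall j, (increment_norm T +oo (EFin \o chi) (h / 2 ^+ j.+1) <=
     ((rho ^+ 3 * 2 `^ (- r^-1)) ^+ j.+1 * G)%:E)%E) ->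
  (increment_norm T +oo (rvariation r (EFin \o chi)) h <= (8 / (1 - rho) ^+ 3 * G)%:E)%E.
Proof.
move=> r1 rho0 rho1 h0 G0 cchi chi0 chiS HG.
have r0 : 0 < r := lt_le_trans ltr01 r1.
have d0 : 0 < 1 - rho by rewrite subr_gt0.
have w0 : 0 < (2 : R) `^ (- r^-1) by rewrite powR_gt0.
set V := rvariation r (EFin \o chi).
have incV0 s : (0 <= increment T V h s)%E.
  by apply: increment_ge0 => *; exact: rvariation_ge0.
have muT := @lebesgue_measure_setT_gt0 R.
have ae1 j i : {ae @lebesgue_measure R, forall s,
    (increment T (EFin \o chi) (h / 2 ^+ j.+1) (translation (h * i%:R / 2 ^+ j.+1) s) <=
     ((rho ^+ 3 * 2 `^ (- r^-1)) ^+ j.+1 * G)%:E)%E}.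
  apply: (ae_translation _ [set u | (increment T (EFin \o chi) (h / 2 ^+ j.+1) u <=
     ((rho ^+ 3 * 2 `^ (- r^-1)) ^+ j.+1 * G)%:E)%E]).
  have := HG j; rewrite increment_normE unlock muT => /ess_supP.
  by apply: filterS => u /= ?; apply: le_trans (lee_abs _) _.
rewrite increment_normE unlock muT; apply/ess_supP.
have : {ae @lebesgue_measure R, forall s, forall j i,
    (increment T (EFin \o chi) (h / 2 ^+ j.+1) (translation (h * i%:R / 2 ^+ j.+1) s) <=
     ((rho ^+ 3 * 2 `^ (- r^-1)) ^+ j.+1 * G)%:E)%E}.
  by apply: ae_foralln => j; apply: ae_foralln => i; exact: ae1.
apply: filterS => s Hs /=; rewrite gee0_abs//.
apply: (@le_trans _ _ (4 / (1 - rho) ^+ 2 * G)%:E).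
  apply: increment_rvariation_le => // s0 sT [//|j] _; set m := j.+1.
  apply: (@le_trans _ _ (\sum_(i < 2 ^ m) ((rho ^+ 3 * 2 `^ (- r^-1)) ^+ m * G) `^ r)).
    apply: ler_sum => i _; apply: ler_powRl => //.
      by rewrite -lee_fin -(increment_dyadic T)// increment_dyadic_ge0.
    by rewrite -lee_fin -(increment_dyadic T)//; exact: Hs.
  rewrite sumr_const card_ord -[leLHS]mulr_natl natrX.
  have -> : (rho ^+ 3 * 2 `^ (- r^-1)) ^+ m * G = (G * (rho ^+ m * rho ^+ m.*2)) * (2 `^ (- r^-1)) ^+ m.
    by rewrite expr3M; ring.
  have a0 : 0 <= G * (rho ^+ m * rho ^+ m.*2).
    by apply: mulr_ge0 => //; apply: mulr_ge0; apply: exprn_ge0; exact: ltW.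
  rewrite powRM ?a0 ?exprn_ge0 ?(ltW w0)//.
  rewrite powR_expr ?(ltW w0)// -powRrM mulNr mulVf ?gt_eqF// powR_inv1//.
  rewrite mulrCA -exprMn mulfV// expr1n mulr1; apply: ler_powRl => //.
  apply: ler_wpM2l => //; apply: ler_piMl; first by apply: exprn_ge0; exact: ltW.
  by apply: exprn_ile1; exact: ltW.
rewrite lee_fin ler_wpM2r//.
have -> : 8 / (1 - rho) ^+ 3 = 8 / (1 - rho) / (1 - rho) ^+ 2 by field; rewrite gt_eqF.
rewrite ler_wpM2r ?invr_ge0 ?exprn_ge0 ?(ltW d0)//.
by rewrite ler_pdivlMr//; lra.
Qed.

(** * A Hardy inequality for nondecreasing functions *)

Definition dyadic_block {R : realType} (T : R) (k : nat) : set R :=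
  `]T / 2 ^+ k.+1, T / 2 ^+ k].

Lemma measurable_dyadic_block {R : realType} (T : R) k : measurable (dyadic_block T k).
Proof. exact: measurable_itv. Qed.

Lemma bigcup_dyadic_block {R : realType} (T : R) : 0 < T ->
  \bigcup_k dyadic_block T k = `]0, T]%classic.
Proof.
move=> T0; apply/seteqP; split => [t [k _]|t].
  rewrite /dyadic_block/= !in_itv/= => /andP[kt tk]; apply/andP; split.
    by rewrite (lt_trans _ kt)// divr_gt0// exprn_gt0.
  by rewrite (le_trans tk)// ler_piMr ?(ltW T0)// invf_le1 ?exprn_gt0// exprn_ege1// ler1n.
rewrite /= in_itv/= => /andP[t0 tT].
have ex : exists n, T / 2 ^+ n < t.
  have /filter_ex[n ?] : \forall n \near \oo, T / 2 ^+ n < t 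
    by exact: (cvgr_lt _ (cvg_div_exp2 T)).
  by exists n.
case: (ex_minnP ex) => -[|k] kt kmin.
  by move: kt; rewrite expr0 divr1 ltNge tT.
exists k => //; rewrite /dyadic_block/= in_itv/= kt/= leNgt; apply/negP => tk.
by have := kmin _ tk; rewrite ltnn.
Qed.

Lemma trivIset_dyadic_block {R : realType} (T : R) : 0 < T ->
  trivIset setT (dyadic_block T).
Proof.
move=> T0; have lt_block i j t : (i < j)%N -> dyadic_block T i t -> dyadic_block T j t -> False.
  rewrite /dyadic_block/= !in_itv/= => ij /andP[it _] /andP[_ tj].
  move: (lt_le_trans it tj); apply/negP; rewrite -leNgt ler_pM2l//.
  by rewrite lef_pV2 ?posrE ?exprn_gt0// ler_eXn2l// ltr1n.
move=> i j _ _ [t [ti tj]]; case: (ltngtP i j) => // ij.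
- by case: (lt_block _ _ _ ij ti tj).
- by case: (lt_block _ _ _ ij tj ti).
Qed.

Lemma lebesgue_measure_dyadic_block {R : realType} (T : R) k : 0 < T ->
  lebesgue_measure (dyadic_block T k) = (T / 2 ^+ k.+1)%:E.
Proof.
move=> T0; have e0 : (2 : R) ^+ k != 0 by rewrite expf_neq0.
rewrite lebesgue_measure_itv/= lte_fin ifT.
  by rewrite -EFinB exprS; congr EFin; field.
by rewrite ltr_pM2l// ltf_pV2 ?posrE ?exprn_gt0// ltr_eXn2l// ltr1n.
Qed.

Definition besov_density {R : realType} (alpha q : R) (A : R -> \bar R) (t : R) : \bar R :=
  ((A t * ((t `^ alpha)^-1)%:E) `^ q * (t^-1)%:E)%E.

(** For a nondecreasing A, the weighted L^q integral of A over ]0, T] is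
    comparable to the sum of the terms (A t / t ^ alpha) ^ q at t = T / 2 ^ k.
    The integral over the block ]T / 2 ^ (k + 1), T / 2 ^ k] lies between
    multiples of the terms at its two end points. *)
Section besov_integral.
Context {R : realType} (T alpha q : R) (A : R -> \bar R).
Hypotheses (T0 : 0 < T) (alpha0 : 0 < alpha) (q0 : 0 < q).
Hypotheses (A0 : forall t, 0 < t -> (0 <= A t)%E)
  (A_le : forall s t, s <= t -> (A s <= A t)%E).

Let u : R := 2 `^ (- alpha).
Let u0 : 0 < u. Proof. exact: powR_gt0. Qed.
Let Tk_gt0 k : 0 < T / 2 ^+ k. Proof. by rewrite divr_gt0// exprn_gt0. Qed.

Let block_gt0 k t : dyadic_block T k t -> 0 < t.
Proof. by rewrite /dyadic_block/= in_itv/= => /andP[kt _]; exact: lt_trans kt. Qed.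

Lemma powR_half x k : 0 <= x -> (x / 2 ^+ k) `^ alpha = x `^ alpha * (2 `^ (- alpha)) ^+ k.
Proof.
by move=> x0; rewrite powRM ?invr_ge0 ?exprn_ge0// -exprVn powR_expr ?invr_ge0// -powR_inv1// -powRrM mulN1r.
Qed.

Let powR_next k : (T / 2 ^+ k.+1) `^ alpha = (T / 2 ^+ k) `^ alpha * u.
Proof. by rewrite !powR_half ?(ltW T0)// exprSr mulrA. Qed.

Lemma besov_density_ge0 t : 0 < t -> (0 <= besov_density alpha q A t)%E.
Proof. by move=> t0; rewrite mule_ge0 ?poweR_ge0// lee_fin invr_ge0 ltW. Qed.

Lemma measurable_besov_density : measurable_fun `]0, T] (besov_density alpha q A).
Proof.
apply: emeasurable_funM.
  apply: (measurableT_comp (measurable_poweR _)) => //.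
  apply: emeasurable_funM; first exact: nondecreasing_emeasurable.
  apply/measurable_EFinP; apply: measurable_funTS.
  by under eq_fun do rewrite -powRN; exact: measurable_powR.
apply/measurable_EFinP; apply: (eq_measurable_fun (fun t : R => t `^ (-1))).
  by move=> t /set_mem/=; rewrite in_itv/= => /andP[t0 _]; rewrite powR_inv1// ltW.
by apply: measurable_funTS; exact: measurable_powR.
Qed.

Lemma integral_besov_density :
  (\int[@lebesgue_measure R]_(t in `]0%R, T]) besov_density alpha q A t =
   \sum_(k <oo) \int[@lebesgue_measure R]_(t in dyadic_block T k) besov_density alpha q A t)%E.
Proof.
have mF := measurable_besov_density; rewrite -bigcup_dyadic_block// in mF *.
apply: ge0_integral_bigcup => //.
- by move=> k; exact: measurable_dyadic_block.
- by move=> t [k _ /block_gt0]; exact: besov_density_ge0.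
- exact: trivIset_dyadic_block.
Qed.

Definition dyadic_besov_term k : \bar R :=
  ((A (T / 2 ^+ k) * (((T / 2 ^+ k) `^ alpha)^-1)%:E) `^ q)%E.

Let measurable_density_block k :
  measurable_fun (dyadic_block T k) (besov_density alpha q A).
Proof.
apply: measurable_funS measurable_besov_density => //.
by rewrite -bigcup_dyadic_block//; exact: bigcup_sup.
Qed.

Let term_scaled_ge0 s t : 0 < s -> (0 <= A s * ((t `^ alpha)^-1)%:E)%E.
Proof. by move=> s0; rewrite mule_ge0 ?A0// lee_fin invr_ge0 powR_ge0. Qed.

Lemma integral_besov_block_le k :
  (\int[@lebesgue_measure R]_(t in dyadic_block T k) besov_density alpha q A t <=
   ((2 `^ (- alpha)) `^ (- q))%:E * dyadic_besov_term k)%E.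
Proof.
set Tk := T / 2 ^+ k; set Tk1 := T / 2 ^+ k.+1.
set c := ((A Tk * ((Tk1 `^ alpha)^-1)%:E) `^ q)%E.
apply: (@le_trans _ _ (\int[@lebesgue_measure R]_(t in dyadic_block T k) (c * Tk1^-1%:E))%E).
  apply: ge0_le_integral => //; first exact: measurable_dyadic_block.
  - by move=> t /block_gt0 t0; exact: besov_density_ge0.
  - exact: measurable_density_block.
  move=> t /[dup] /block_gt0 t0; rewrite /dyadic_block/= in_itv/= => /andP[kt tk].
  apply: lee_pmul; rewrite ?poweR_ge0 ?lee_fin ?invr_ge0 ?(ltW t0)//.
    apply: le_poweR; rewrite ?(ltW q0) ?term_scaled_ge0 ?Tk_gt0//.
    apply: lee_pmul; [exact: A0|by rewrite lee_fin invr_ge0 powR_ge0|exact: A_le|].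
    by rewrite lee_fin lef_pV2 ?posrE ?powR_gt0 ?Tk_gt0//; apply: ler_powRl => //; rewrite ltW// Tk_gt0.
  by rewrite lef_pV2 ?posrE ?Tk_gt0// ltW.
rewrite integral_cst; last exact: measurable_dyadic_block.
rewrite [X in (_ * X)%E](lebesgue_measure_dyadic_block _ _ T0) -/Tk1 -muleA -EFinM mulVf ?(gt_eqF (Tk_gt0 _))// mule1.
rewrite /c /dyadic_besov_term -/Tk.
have -> : (Tk1 `^ alpha)^-1 = (Tk `^ alpha)^-1 * u^-1.
  by rewrite /Tk1 powR_next invfM.
rewrite EFinM muleA [leLHS]poweRM ?term_scaled_ge0 ?Tk_gt0 ?lee_fin ?invr_ge0 ?(ltW u0)//.
have -> : (2 `^ (- alpha)) `^ (- q) = u^-1 `^ q by rewrite -(powR_inv1 (ltW u0)) -[RHS]powRrM mulN1r.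
by rewrite muleC.
Qed.

Lemma integral_besov_block_ge k :
  (((2 `^ (- alpha)) `^ q / 2)%:E * dyadic_besov_term k.+1 <=
   \int[@lebesgue_measure R]_(t in dyadic_block T k) besov_density alpha q A t)%E.
Proof.
set Tk := T / 2 ^+ k; set Tk1 := T / 2 ^+ k.+1.
set c := ((A Tk1 * ((Tk `^ alpha)^-1)%:E) `^ q)%E.
apply: (@le_trans _ _ (\int[@lebesgue_measure R]_(t in dyadic_block T k) (c * Tk^-1%:E))%E); last first.
  apply: ge0_le_integral => //; first exact: measurable_dyadic_block.
  - by move=> t _; rewrite mule_ge0 ?poweR_ge0// lee_fin invr_ge0 ltW// Tk_gt0.
  - exact: measurable_density_block.
  move=> t /[dup] /block_gt0 t0; rewrite /dyadic_block/= in_itv/= => /andP[kt tk].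
  apply: lee_pmul; rewrite ?poweR_ge0 ?lee_fin ?invr_ge0 ?(ltW (Tk_gt0 _))//.
    apply: le_poweR; rewrite ?(ltW q0) ?term_scaled_ge0 ?Tk_gt0//.
    apply: lee_pmul; [exact/A0/Tk_gt0|by rewrite lee_fin invr_ge0 powR_ge0|exact/A_le/ltW|].
    by rewrite lee_fin lef_pV2 ?posrE ?powR_gt0 ?Tk_gt0//; apply: ler_powRl => //; exact: ltW.
  by rewrite lef_pV2 ?posrE ?Tk_gt0.
rewrite integral_cst; last exact: measurable_dyadic_block.
rewrite [X in (_ <= _ * X)%E](lebesgue_measure_dyadic_block _ _ T0) -/Tk1 -muleA -EFinM.
have -> : Tk^-1 * Tk1 = 2^-1.
  have e0 : (2 : R) ^+ k != 0 by rewrite expf_neq0.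
  by rewrite /Tk /Tk1 exprS; field; rewrite e0 gt_eqF.
rewrite /c /dyadic_besov_term -/Tk1.
have -> : (Tk `^ alpha)^-1 = (Tk1 `^ alpha)^-1 * u.
  by rewrite /Tk1 powR_next invfM mulfVK ?gt_eqF.
rewrite [X in (_ <= (A Tk1 * X) `^ q * _)%E]EFinM [X in (_ <= X `^ q * _)%E]muleA.
rewrite [X in (_ <= X * _)%E]poweRM ?term_scaled_ge0 ?Tk_gt0 ?lee_fin ?(ltW u0)//.
by rewrite poweR_EFin -muleA -EFinM muleC.
Qed.

End besov_integral.

(** A discrete Hardy inequality. The assumption WA says that W t is at most
    K times the supremum over j >= 1 of A (t / 2 ^ j) / tau ^ j. As tau exceeds
    2 ^ (- alpha), dividing by t ^ alpha turns this into a convolution with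
    a summable geometric sequence. *)
Section besov_comparison.
Context {R : realType} (T alpha K tau : R) (A W : R -> \bar R).
Hypotheses (T0 : 0 < T) (alpha0 : 0 < alpha) (K0 : 0 < K).
Hypotheses (A0 : forall t, 0 < t -> (0 <= A t)%E)
  (A_le : forall s t, s <= t -> (A s <= A t)%E)
  (W0 : forall t, 0 < t -> (0 <= W t)%E)
  (W_le : forall s t, s <= t -> (W s <= W t)%E).
Hypothesis tau_gt : 2 `^ (- alpha) < tau.
Hypothesis WA : forall t (G : \bar R), 0 < t -> t <= T -> (0 <= G)%E ->
  (forall j, A (t / 2 ^+ j.+1) <= (tau ^+ j.+1)%:E * G)%E -> (W t <= K%:E * G)%E.

Let u : R := 2 `^ (- alpha).
Let u0 : 0 < u. Proof. exact: powR_gt0. Qed.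
Let tau0 : 0 < tau. Proof. exact: lt_trans tau_gt. Qed.
Let Tk_gt0 k : 0 < T / 2 ^+ k. Proof. by rewrite divr_gt0// exprn_gt0. Qed.
Let Tk_le k : T / 2 ^+ k <= T.
Proof. by rewrite ler_piMr ?(ltW T0)// invf_le1 ?exprn_gt0// exprn_ege1// ler1n. Qed.

Section finite_q.
Variable q : R.
Hypothesis q0 : 0 < q.
Let theta : R := (u / tau) `^ q.
Let theta0 : 0 < theta. Proof. by rewrite powR_gt0// divr_gt0. Qed.
Let theta1 : theta < 1.
Proof.
have : (u / tau) `^ q < 1 `^ q.
  by apply: gt0_ltr_powR; rewrite ?nnegrE ?divr_ge0 ?(ltW u0) ?(ltW tau0)// ltr_pdivrMr// mul1r.
by rewrite powR1.
Qed.

Let a k := dyadic_besov_term T alpha q A k.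
Let a0 k : (0 <= a k)%E. Proof. exact: poweR_ge0. Qed.

(** A supremum over j is at most the l^q norm, which makes the argument
    uniform in q > 0, including q < 1. *)
Lemma dyadic_besov_term_le k :
  (dyadic_besov_term T alpha q W k <=
   (K `^ q)%:E * \sum_(i <oo) (theta ^+ i.+1)%:E * a (k + i.+1))%E.
Proof.
set S := (\sum_(i <oo) _)%E; set Tk := T / 2 ^+ k.
have S0 : (0 <= S)%E by apply: nneseries_ge0 => i _ _; rewrite mule_ge0// lee_fin exprn_ge0// ltW.
have Tka : 0 < Tk `^ alpha by rewrite powR_gt0// Tk_gt0.
(* The l^q norm S ^ (1 / q) of the sequence serves as G, up to the weight. *)
have WG : (W Tk <= K%:E * (S `^ q^-1 * (Tk `^ alpha)%:E))%E.
  apply: WA => //; [exact: Tk_gt0|exact: Tk_le|by rewrite mule_ge0 ?poweR_ge0// lee_fin ltW|].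
  move=> j; set m := j.+1.
  have le_S : ((theta ^+ m)%:E * a (k + m) <= S)%E.
    rewrite (le_trans _ (nneseries_lim_ge m _))//; last first.
      by move=> i _ _; rewrite mule_ge0// lee_fin exprn_ge0// ltW.
    rewrite big_nat_recr//= leeDr// sume_ge0// => i _.
    by rewrite mule_ge0// lee_fin exprn_ge0// ltW.
  have Tm : Tk / 2 ^+ m = T / 2 ^+ (k + m) by rewrite /Tk exprD invfM mulrA.
  have am0 : (0 <= A (Tk / 2 ^+ m) * (((Tk / 2 ^+ m) `^ alpha)^-1)%:E)%E.
    by rewrite mule_ge0 ?A0 ?Tm ?Tk_gt0// lee_fin invr_ge0 powR_ge0.
  have := le_poweR q^-1 _ _ _ _ le_S; rewrite invr_ge0 (ltW q0) => /(_ isT).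
  rewrite mule_ge0 ?lee_fin ?exprn_ge0 ?(ltW theta0)// => /(_ isT).
  rewrite poweRM ?lee_fin ?exprn_ge0 ?(ltW theta0)// {1}/a /dyadic_besov_term -Tm poweRK//.
  have -> : ((theta ^+ m)%:E `^ q^-1 = ((u / tau) ^+ m)%:E)%E.
    by rewrite poweR_EFin /theta -powR_expr ?powRK ?exprn_ge0 ?divr_ge0 ?(ltW u0) ?(ltW tau0).
  rewrite powR_half ?(ltW (Tk_gt0 _))// -/u => le1.
  have um : 0 < u ^+ m by rewrite exprn_gt0.
  have tm : 0 < tau ^+ m by rewrite exprn_gt0.
  have := lee_wpmul2l _ le1.
  move=> /(_ (tau ^+ m * Tk `^ alpha)%:E); rewrite lee_fin mulr_ge0 ?(ltW tm) ?(ltW Tka)// => /(_ isT) le2.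
  have -> : (A (Tk / 2 ^+ m) = (tau ^+ m * Tk `^ alpha)%:E *
      (((u / tau) ^+ m)%:E * (A (Tk / 2 ^+ m) * ((Tk `^ alpha * u ^+ m)^-1)%:E)))%E.
    rewrite [((_ ^+ m)%:E * _)%E]muleCA -EFinM muleCA -EFinM -[LHS]mule1; congr (_ * _%:E)%E.
    by rewrite expr_div_n; field; rewrite !gt_eqF.
  by apply: (le_trans le2); rewrite EFinM -muleA [((Tk `^ alpha)%:E * _)%E]muleC.
rewrite /dyadic_besov_term -/Tk.
rewrite -[S](poweRVK _ _ q0 S0) -poweR_EFin -poweRM ?poweR_ge0// ?lee_fin ?(ltW K0)//.
apply: le_poweR; first exact: ltW.
  by rewrite mule_ge0 ?W0 ?Tk_gt0// lee_fin invr_ge0 ltW.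
apply: (le_trans (lee_wpmul2r _ WG)); first by rewrite lee_fin invr_ge0 ltW.
by rewrite -!muleA -EFinM mulfV ?gt_eqF// mule1.
Qed.

Lemma besov_integral_le :
  (\int[@lebesgue_measure R]_(t in `]0%R, T]) besov_density alpha q W t <=
   ((2 `^ (- alpha)) `^ (- q) * K `^ q / (1 - theta) / ((2 `^ (- alpha)) `^ q / 2))%:E *
   \int[@lebesgue_measure R]_(t in `]0%R, T]) besov_density alpha q A t)%E.
Proof.
have d0 : 0 < 1 - theta by rewrite subr_gt0.
have uq0 : 0 < u `^ q / 2 by rewrite divr_gt0// powR_gt0.
set I := (X in (_ <= _ * X)%E).
pose B := (\sum_(k <oo) a k.+1)%E.
have B0 : (0 <= B)%E by apply: nneseries_ge0.
have BI : (B <= ((u `^ q / 2)^-1)%:E * I)%E.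
  rewrite lee_pdivlMl// -nneseriesZl; last by move=> *; exact: a0.
  rewrite /I integral_besov_density//; apply: lee_nneseries => [k _ _|k _].
    by rewrite mule_ge0// lee_fin ltW.
  exact: integral_besov_block_ge.
rewrite integral_besov_density//.
apply: (@le_trans _ _ (\sum_(k <oo) (u `^ (- q) * K `^ q)%:E *
    \sum_(i <oo) (theta ^+ i.+1)%:E * a (k + i.+1))%E).
  apply: lee_nneseries => [k _ _|k _].
    apply: integral_ge0 => t; rewrite /dyadic_block/= in_itv/= => /andP[kt _].
    apply: besov_density_ge0 => //; exact: lt_trans kt.
  apply: (le_trans (integral_besov_block_le _ _ _ _ _ _ _ _ _ k)) => //.
  by rewrite EFinM -muleA lee_wpmul2l ?lee_fin ?powR_ge0// dyadic_besov_term_le.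
have term0 i k : (0 <= (theta ^+ i.+1)%:E * a (k + i.+1))%E.
  by rewrite mule_ge0// lee_fin exprn_ge0// ltW.
rewrite nneseriesZl; last by move=> k _; apply: nneseries_ge0.
have c0 : 0 <= u `^ (- q) * K `^ q by rewrite mulr_ge0 ?powR_ge0.
rewrite nneseries_interchange//.
rewrite -[X in (_ <= X%:E * _)%E]mulrA [X in (_ <= X * _)%E]EFinM -[leRHS]muleA.
rewrite lee_wpmul2l ?lee_fin// [X in (_ <= X * _)%E]EFinM -[leRHS]muleA.
apply: (le_trans _ (lee_wpmul2l _ BI)); last by rewrite lee_fin invr_ge0 ltW.
apply: (le_trans _ (nneseries_geometricM_le _ _ theta0 theta1 B0)).
apply: lee_nneseries => [i _ _|i _]; first by apply: nneseries_ge0.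
rewrite nneseriesZl; last by move=> *; exact: a0.
apply: lee_wpmul2l; first by rewrite lee_fin exprn_ge0// ltW.
apply: le_trans (nneseries_shift_le (fun k => a k.+1) i (fun k => a0 k.+1)).
by apply: lee_nneseries => // k _; rewrite addnS.
Qed.

End finite_q.

(** Some t in ]s, 2 s] realizes the almost everywhere bound, and A s <= A t
    while t ^ alpha <= 2 ^ alpha * s ^ alpha. *)
Lemma ess_sup_besov_ge s : 0 < s -> s <= T / 2 ->
  (A s <= Lnorm (@lebesgue_measure R) +oo
            ((fun t => A t * ((t `^ alpha)^-1)%:E) \_ `]0%R, T]) *
          ((2 `^ (- alpha))^-1 * s `^ alpha)%:E)%E.
Proof.
move=> s0 sT; set N := Lnorm _ _ _.
have [t [st ts tN]] : exists t, [/\ s < t, t <= 2 * s & (A t * ((t `^ alpha)^-1)%:E <= N)%E].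
  have muT := @lebesgue_measure_setT_gt0 R.
  have NE : N = ess_sup (@lebesgue_measure R)
     (abse \o ((fun t => A t * ((t `^ alpha)^-1)%:E) \_ `]0%R, T]))%E.
    by rewrite /N unlock muT.
  have [M [mM M0 PM]] := ess_sup_ge (@lebesgue_measure R)
    (abse \o ((fun t => A t * ((t `^ alpha)^-1)%:E) \_ `]0%R, T]))%E.
  apply: contrapT => /forallNP noT.
  have sub : `]s, (2 * s)]%classic `<=` M.
    move=> t /=; rewrite in_itv/= => /andP[st ts]; apply: PM => /= tN.
    apply: (noT t); split=> //; rewrite NE; apply: le_trans tN; rewrite patchE ifT; last first.
      by rewrite inE/= in_itv/=; apply/andP; split; [exact: lt_trans st|lra].
    exact: lee_abs.
  have : (@lebesgue_measure R `]s, (2 * s)%R] <= 0)%E.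
    rewrite -M0; apply: le_measure => //; rewrite inE //; exact: measurable_itv.
  rewrite lebesgue_measure_itv/= lte_fin ifT; last by lra.
  by rewrite -EFinB lee_fin; apply/negP; rewrite -ltNge; lra.
have t0 : 0 < t by exact: lt_trans st.
have ta : 0 < t `^ alpha by rewrite powR_gt0.
have N0 : (0 <= N)%E by exact: Lnorm_ge0.
apply: (@le_trans _ _ (N * (t `^ alpha)%:E)%E).
  apply: (le_trans (A_le _ _ (ltW st))).
  have := lee_wpmul2r _ tN; move=> /(_ (t `^ alpha)%:E); rewrite lee_fin ltW// => /(_ isT).
  by rewrite -muleA -EFinM mulVf ?gt_eqF// mule1.
rewrite lee_wpmul2l// lee_fin powRN invrK -powRM ?(ltW s0)//.
by apply: ler_powRl => //; exact: ltW.
Qed.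

Lemma besov_sup_le :
  (Lnorm (@lebesgue_measure R) +oo ((fun t => W t * ((t `^ alpha)^-1)%:E) \_ `]0%R, T]) <=
   (K / 2 `^ (- alpha))%:E *
   Lnorm (@lebesgue_measure R) +oo ((fun t => A t * ((t `^ alpha)^-1)%:E) \_ `]0%R, T]))%E.
Proof.
set N := (X in (_ <= _ * X)%E); have N0 : (0 <= N)%E by exact: Lnorm_ge0.
have muT := @lebesgue_measure_setT_gt0 R.
have Ku : 0 <= K / u by rewrite divr_ge0// ltW.
rewrite unlock muT; apply/ess_supP; apply: nearW => t /=; rewrite patchE.
case: ifPn => [|_]; last by rewrite abse0 mule_ge0.
rewrite inE/= in_itv/= => /andP[t0 tT].
have ta : 0 < t `^ alpha by rewrite powR_gt0.
have ua : 0 <= u^-1 * t `^ alpha by rewrite mulr_ge0 ?invr_ge0 ?ltW.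
rewrite gee0_abs; last by rewrite mule_ge0 ?W0// lee_fin invr_ge0 ltW.
have := WA t (N * (u^-1 * t `^ alpha)%:E)%E t0 tT.
rewrite mule_ge0// => /(_ isT) WN.
rewrite lee_pdivrMr//; apply: (le_trans (WN _)); last first.
  by rewrite muleCA -EFinM [((K / u)%:E * N)%E]muleC -muleA -EFinM mulrA.
move=> j; set m := j.+1.
have tm0 : 0 < t / 2 ^+ m by rewrite divr_gt0// exprn_gt0.
have tmT : t / 2 ^+ m <= T / 2.
  rewrite (@le_trans _ _ (T / 2 ^+ m))//; first by rewrite ler_pM2r ?invr_gt0 ?exprn_gt0.
  by rewrite ler_pM2l// lef_pV2 ?posrE ?exprn_gt0// ler_eXnr ?ler1n.
apply: (le_trans (ess_sup_besov_ge _ tm0 tmT)).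
rewrite muleCA lee_wpmul2l// -EFinM lee_fin powR_half ?(ltW t0)// -/u.
rewrite [leRHS]mulrCA ler_wpM2l ?invr_ge0 ?(ltW u0)//.
by rewrite [leRHS]mulrC ler_wpM2l ?(ltW ta)// lerXn2r ?nnegrE ?ltW.
Qed.

End besov_comparison.

(** * The modulus of the r-variation and the theorem *)

Lemma Omega_le {R : realType} (T : R) p (chi : R * R -> \bar R) s t : s <= t ->
  (Omega T p chi s <= Omega T p chi t)%E.
Proof.
move=> st; apply: ereal_sup_le; apply: image_subset => h /=.
by rewrite !in_itv/= => /andP[-> hs]; exact: le_trans st.
Qed.

Lemma increment_norm_le_Omega {R : realType} (T : R) p (chi : R * R -> \bar R) h t :
  0 < h -> h <= t -> (increment_norm T p chi h <= Omega T p chi t)%E.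
Proof.
by move=> h0 ht; apply: ereal_sup_ubound; exists h => //=; rewrite in_itv/= h0.
Qed.

Lemma Omega_ge0 {R : realType} (T : R) p (chi : R * R -> \bar R) t : 0 < t ->
  (0 <= Omega T p chi t)%E.
Proof.
move=> t0; apply: le_trans (increment_norm_le_Omega T p chi t t t0 (lexx t)).
exact: Lnorm_ge0.
Qed.

(** The conclusion for all increments h <= t at once, as Omega is monotone. *)
Lemma Omega_rvariation_le {R : realType} (T r rho : R) (p : \bar R) (chi : R * R -> R) :
  1 <= r -> 0 < rho -> rho < 1 -> (r%:E <= p)%E ->
  {within Delta T, continuous chi} ->
  (forall st, Delta T st -> 0 <= chi st) -> subadditive_on T chi ->
  forall t (G : \bar R), 0 < t -> t <= T -> (0 <= G)%E ->
  (forall j, Omega T p (EFin \o chi) (t / 2 ^+ j.+1)%R <=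
     ((rho ^+ 3 * 2 `^ (- r^-1)) ^+ j.+1)%:E * G)%E ->
  (Omega T p (rvariation r (EFin \o chi)) t <= (8 / (1 - rho) ^+ 3)%:E * G)%E.
Proof.
move=> r1 rho0 rho1 rp cchi chi0 chiS t [G||//] t0 tT G0 HG; last first.
  by rewrite gt0_muley ?leey// lte_fin divr_gt0// exprn_gt0// subr_gt0.
rewrite lee_fin in G0; rewrite -EFinM.
apply: ge_ereal_sup => _ [h /= + <-]; rewrite in_itv/= => /andP[h0 ht].
have HG' j : (increment_norm T p (EFin \o chi) (h / 2 ^+ j.+1) <=
    ((rho ^+ 3 * 2 `^ (- r^-1)) ^+ j.+1 * G)%:E)%E.
  rewrite EFinM; apply: le_trans (HG j); apply: increment_norm_le_Omega.
    by rewrite divr_gt0// exprn_gt0.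
  by rewrite ler_pM2r// invr_gt0 exprn_gt0.
case: p rp HG' {HG} => [p| |//] rp HG'.
- exact: (increment_norm_rvariation_le_fin T r rho h p G chi r1 rho0 rho1 rp h0 G0 cchi chi0 chiS HG').
- exact: (increment_norm_rvariation_le_pinfty T r rho h G chi r1 rho0 rho1 h0 G0 cchi chi0 chiS HG').
Qed.

Theorem theorem2p20 (R : realType) (r alpha : R) (p q : \bar R)
    (hr : 1 <= r) (halpha : 0 < alpha) (hp : (0 < p)%E) (hq : (0 < q)%E)
    (halphar : alpha^-1 < r) (hrp : (r%:E <= p)%E) :
  exists c : R, 0 < c /\
    forall (T : R), 0 < T ->
    forall chi : R * R -> R,
      {within Delta T, continuous chi} ->
      (forall st : R * R, Delta T st -> 0 <= chi st) ->
      subadditive_on T chi ->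
      (besov T alpha p q (rvariation r (EFin \o chi))
         <= c%:E * besov T alpha p q (EFin \o chi))%E.
Proof.
have r0 : 0 < r := lt_le_trans ltr01 hr.
have w0 : 0 < (2 : R) `^ (- r^-1) by rewrite powR_gt0.
pose d := alpha - r^-1.
have d0 : 0 < d by rewrite subr_gt0 -[alpha]invrK ltf_pV2 ?posrE ?invr_gt0.
(* This makes 2 ^ (- alpha) equal to rho ^ 4 * 2 ^ (- 1 / r). *)
pose rho : R := 2 `^ (- (d / 4)).
have rho0 : 0 < rho by rewrite powR_gt0.
have rho1 : rho < 1.
  rewrite /rho powRN invf_lt1 ?powR_gt0//.
  have : 1 `^ (d / 4) < (2 : R) `^ (d / 4).
    by apply: gt0_ltr_powR; rewrite ?nnegrE ?divr_gt0// ltr1n.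
  by rewrite powR1.
pose tau := rho ^+ 3 * 2 `^ (- r^-1).
have tau0 : 0 < tau by rewrite mulr_gt0// exprn_gt0.
have uE : 2 `^ (- alpha) = rho * tau.
  rewrite /tau mulrA -exprS /rho -powR_mulrn ?powR_ge0// -powRrM -powRD; last first.
    by rewrite pnatr_eq0 implybT.
  by congr (_ `^ _); rewrite /d; lra.
have u_tau : 2 `^ (- alpha) < tau by rewrite uE gtr_pMl.
have u0 : 0 < (2 : R) `^ (- alpha) by rewrite powR_gt0.
pose K : R := 8 / (1 - rho) ^+ 3.
have K0 : 0 < K by rewrite divr_gt0// exprn_gt0// subr_gt0.
case: q hq => [q' q0|_|//].
- rewrite lte_fin in q0.
  pose c0 : R := (2 `^ (- alpha)) `^ (- q') * K `^ q' / (1 - (2 `^ (- alpha) / tau) `^ q') /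
    ((2 `^ (- alpha)) `^ q' / 2).
  have c00 : 0 < c0.
    rewrite /c0 !mulr_gt0 ?powR_gt0// ?invr_gt0 ?mulr_gt0 ?powR_gt0// ?invr_gt0//.
    have : (2 `^ (- alpha) / tau) `^ q' < 1 `^ q'.
      by apply: gt0_ltr_powR; rewrite ?nnegrE ?divr_ge0 ?(ltW u0) ?(ltW tau0)// ltr_pdivrMr// mul1r.
    by rewrite powR1 subr_gt0.
  exists (c0 `^ q'^-1); split; first by rewrite powR_gt0.
  move=> T T0 chi cchi chi0 chiS.
  rewrite /besov -poweR_EFin -poweRM ?lee_fin ?(ltW c00)//; last first.
    apply: integral_ge0 => t /=; rewrite in_itv/= => /andP[t0 _].
    by rewrite mule_ge0 ?poweR_ge0// lee_fin invr_ge0 ltW.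
  apply: le_poweR; first by rewrite invr_ge0 ltW.
    apply: integral_ge0 => t /=; rewrite in_itv/= => /andP[t0 _].
    by rewrite mule_ge0 ?poweR_ge0// lee_fin invr_ge0 ltW.
  apply: (besov_integral_le T alpha K tau
    (Omega T p (EFin \o chi)) (Omega T p (rvariation r (EFin \o chi)))) => //.
  + by move=> t t0; apply: Omega_ge0.
  + by move=> s t; exact: Omega_le.
  + by move=> t t0; apply: Omega_ge0.
  + by move=> s t; exact: Omega_le.
  + by move=> t G; exact: Omega_rvariation_le.
- exists (K / 2 `^ (- alpha)); split; first by rewrite divr_gt0.
  move=> T T0 chi cchi chi0 chiS.
  apply: (besov_sup_le T alpha K tau
    (Omega T p (EFin \o chi)) (Omega T p (rvariation r (EFin \o chi)))) => //.
  + by move=> s t; exact: Omega_le.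
  + by move=> t t0; apply: Omega_ge0.
  + by move=> t G; exact: Omega_rvariation_le.
Qed.
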